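(* The space $(\mathscr P_\sim(\mathbb U),W_H)$ is a complete separable length metric space whose induced topology coincides with the quotient topology on $\mathscr P_\sim(\mathbb U)=\mathscr P(\mathbb U)/\sim$ (where $\mathscr P(\mathbb U)$ carries the topology induced by $W$, i.e. the weak topology). Moreover, it holds that $$\bar W(\theta,\eta)={\rm dist}_W(\theta,\eta)=W_H(\theta,\eta)\quad\text{ for every }\theta,\eta\in\mathscr P_\sim(\mathbb U).$$
   Context: ''Isometry'' means distance-preserving map (not necessarily surjective). $(\mathbb U,\mathsf d_{\mathbb U})$ is the Urysohn universal metric space: the unique (up to isometric bijection) complete separable metric space that is universal (every separable metric space embeds isometrically in it) and ultrahomogeneous (every isometry $\phi\colon F\to\mathbb U$ defined on a finite subset $F\subseteq\mathbb U$ extends to an isometric bijection $\mathbb U\to\mathbb U$). $\mathscr P(\mathbb U)$ is the set of Borel probability measures on $\mathbb U$. For $\mu,\nu\in\mathscr P(\mathbb U)$, ${\rm Adm}(\mu;\nu)$ is the set of $\pi\in\mathscr P(\mathbb U\times\mathbb U)$ with first marginal $\mu$ and second marginal $\nu$, and the truncated $1$-Wasserstein distance is $$W(\mu,\nu):=\inf_{\pi\in{\rm Adm}(\mu;\nu)}\int \mathsf d_{\mathbb U}\wedge 1\,{\rm d}\pi.$$ $W$ is a distance metrising weak convergence (in duality with bounded continuous functions). Equivalence relation on $\mathscr P(\mathbb U)$: $\mu\sim\nu$ iff there is an isometric bijection $\phi\colon{\rm spt}(\mu)\to{\rm spt}(\nu)$ between the supports with $\phi_\#\mu=\nu$ (pushforward).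 $\mathscr P_\sim(\mathbb U):=\mathscr P(\mathbb U)/\sim$; its elements are regarded as subsets of $\mathscr P(\mathbb U)$. For $\theta,\eta\in\mathscr P_\sim(\mathbb U)$: $$W_H(\theta,\eta):=\max\Big\{\sup_{\mu\in\theta}\inf_{\nu\in\eta}W(\mu,\nu),\ \sup_{\nu\in\eta}\inf_{\mu\in\theta}W(\mu,\nu)\Big\},\qquad {\rm dist}_W(\theta,\eta):=\inf_{(\mu,\nu)\in\theta\times\eta}W(\mu,\nu),$$ $$\bar W(\theta,\eta):=\inf\sum_{i=1}^n W(\mu_i,\nu_i),$$ the last infimum being over all $n\in\mathbb N$ and $(\mu_i)_{i=1}^n,(\nu_i)_{i=1}^n\subseteq\mathscr P(\mathbb U)$ with $(\mu_1,\nu_n)\in\theta\times\eta$ and $\nu_i\sim\mu_{i+1}$ for $i=1,\dots,n-1$. *)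

(* Defs.v *)
From HB Require Import structures.
From mathcomp Require Import all_boot all_order all_algebra.
From mathcomp Require Import all_classical all_reals all_analysis.
From mathcomp Require Import generic_quotient.

Set Implicit Arguments.
Unset Strict Implicit.
Unset Printing Implicit Defensive.

Import Order.TTheory GRing.Theory Num.Theory.
Import numFieldNormedType.Exports.

Local Open Scope classical_set_scope.
Local Open Scope ring_scope.

(* [g_sigma_algebraType] needs a pointed carrier; the base point is arbitrary
   and plays no role otherwise. *)
#[short(type="pmetricType")]
HB.structure Definition PMetric (R : numDomainType) :=
  {M of Pointed M & Metric R M}.

Definition isometry_on (R : numDomainType) (M N : metricType R)
    (A : set M) (f : M -> N) :=
  forall x y, A x -> A y -> mdist (f x) (f y) = mdist x y.

Definition complete_metric (R : numDomainType) (M : metricType R) :=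
  forall F : set_system M, ProperFilter F -> cauchy F ->
    exists l : M, F --> l.

Definition separable_metric (R : numDomainType) (M : metricType R) :=
  exists2 D : set M, countable D & dense D.

Section length_space.
Context {R : realType} {M : metricType R}.

(* Same partitions as in the library's [variation], which is only defined for
   functions with values in R. *)
Definition polygonal_length (g : R -> M) (a b : R) (s : seq R) : R :=
  let G := g \o nth b (a :: s) in
  \sum_(0 <= n < size s) mdist (G n) (G n.+1).

Definition curve_length (g : R -> M) : \bar R :=
  ereal_sup [set (polygonal_length g 0 1 s)%:E | s in itv_partition 0 1].

Definition curves (x y : M) : set (R -> M) :=
  [set g : R -> M |
    [/\ {within `[0, 1], continuous g}, g 0 = x & g 1 = y]].

End length_space.

Definition length_space (R : realType) (M : metricType R) :=
  forall x y : M,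
    (mdist x y)%:E = ereal_inf [set curve_length g | g in curves x y].

Definition universal_metric (R : realType) (U : metricType R) :=
  forall X : metricType R, separable_metric X ->
    exists f : X -> U, isometry_on setT f.

Definition ultrahomogeneous_metric (R : realType) (U : metricType R) :=
  forall (F : set U) (phi : U -> U), finite_set F -> isometry_on F phi ->
    exists g : U -> U, [/\ bijective g, isometry_on setT g
                         & forall x, F x -> g x = phi x].

Definition urysohn (R : realType) (U : metricType R) :=
  [/\ complete_metric U, separable_metric U, universal_metric U
    & ultrahomogeneous_metric U].

(* The library gives both structures to a product, but not their join. *)
HB.instance Definition _ (T T' : ptopologicalType) :=
  Pointed.on (T * T')%type.

Definition borel (T : ptopologicalType) := g_sigma_algebraType (@open T).

(* A [probability] is a function on all subsets, constrained only on the
   measurable ones. Two such functions which agree on the Borel sets are at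
   [Wass] distance 0 and [prob_equiv]-equivalent, hence they are identified in
   the quotient [prob_quot]. *)
Definition borel_prob (R : realType) (T : ptopologicalType) : Type :=
  probability (borel T) R.

Section prob.
Context {R : realType} {U : pmetricType R}.
Local Notation P := (borel_prob R U).

(* The sigma-algebra on [U * U] is the Borel one of the product topology. *)
Definition Adm (mu nu : P) : set (borel_prob R (U * U)%type) :=
  [set pi : borel_prob R (U * U)%type |
   forall A : set U, measurable (A : set (borel U)) ->
     pi (fst @^-1` A) = mu A /\ pi (snd @^-1` A) = nu A].

Definition Wass (mu nu : P) : \bar R :=
  ereal_inf [set (\int[pi]_(z in [set: borel (U * U)%type])
                    (Num.min (mdist z.1 z.2) 1)%:E)%E | pi in Adm mu nu].

Definition spt (mu : P) : set U :=
  [set x | forall A : set U, open A -> A x -> (0 < mu A)%E].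

(* [phi] only matters on [spt mu], which carries [mu]. *)
Definition prob_equiv (mu nu : P) : Prop :=
  exists phi : U -> U,
    [/\ set_bij (spt mu) (spt nu) phi, isometry_on (spt mu) phi
      & forall A : set U, measurable (A : set (borel U)) ->
          mu (spt mu `&` phi @^-1` A) = nu A].

Definition prob_open (A : set P) : Prop :=
  forall mu, A mu -> exists2 e : R, 0 < e &
    forall nu, (Wass mu nu < e%:E)%E -> A nu.

Lemma prob_openT : prob_open setT.
Proof. by move=> mu _; exists 1. Qed.

Lemma prob_openI A B : prob_open A -> prob_open B -> prob_open (A `&` B).
Proof.
move=> oA oB mu [/oA[a a0 aA] /oB[b b0 bB]].
exists (Num.min a b); first by rewrite lt_min a0.
by move=> nu; rewrite EFin_min lt_min => /andP[/aA ? /bB ?].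
Qed.

Lemma prob_open_bigcup (I : Type) (f : I -> set P) :
  (forall i, prob_open (f i)) -> prob_open (\bigcup_i f i).
Proof.
move=> of_ mu [i _ /of_[e e0 ef]]; exists e => // nu /ef ?.
by exists i.
Qed.

End prob.

HB.instance Definition _ (R : realType) (T : ptopologicalType) :=
  gen_eqMixin (borel_prob R T).
HB.instance Definition _ (R : realType) (T : ptopologicalType) :=
  gen_choiceMixin (borel_prob R T).

Definition prob (R : realType) (U : pmetricType R) : Type := borel_prob R U.
HB.instance Definition _ (R : realType) (U : pmetricType R) :=
  Choice.on (prob U).
HB.instance Definition _ (R : realType) (U : pmetricType R) :=
  @isOpenTopological.Build (prob U) (@prob_open R U)
    (@prob_openT R U) (@prob_openI R U) (@prob_open_bigcup R U).

Section quotient.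
Context {R : realType} {U : pmetricType R}.

Definition prob_quot : Type :=
  {theta : set (prob U) | exists mu, theta = [set nu | prob_equiv mu nu]}.

Definition prob_class (mu : prob U) : prob_quot :=
  exist _ [set nu | prob_equiv mu nu] (ex_intro _ mu erefl).

Definition prob_repr (theta : prob_quot) : prob U :=
  projT1 (cid (proj2_sig theta)).

Lemma prob_reprK : cancel prob_repr prob_class.
Proof.
move=> [theta h]; rewrite /prob_class /prob_repr; apply: eq_exist => /=.
by case: cid => mu /= e; rewrite [RHS]e.
Qed.

HB.instance Definition _ := isQuotient.Build (prob U) prob_quot prob_reprK.

Local Open Scope ereal_scope.

Implicit Types theta eta : set (prob U).

Definition W_H theta eta : \bar R :=
  maxe (ereal_sup [set ereal_inf [set Wass mu nu | nu in eta] | mu in theta])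
       (ereal_sup [set ereal_inf [set Wass mu nu | mu in theta] | nu in eta]).

Definition dist_W theta eta : \bar R :=
  ereal_inf [set Wass p.1 p.2 | p in theta `*` eta].

(* Chains of length n.+1, with indices starting at 0. *)
Definition W_bar theta eta : \bar R :=
  ereal_inf [set r | exists (n : nat) (mu nu : nat -> prob U),
    [/\ theta (mu 0%N), eta (nu n),
        forall i, (i < n)%N -> prob_equiv (nu i) (mu i.+1)
      & r = \sum_(i < n.+1) Wass (mu i) (nu i)]].

End quotient.
Arguments prob_quot {R} U.
Coercion prob_quot_set (R : realType) (U : pmetricType R)
  (theta : prob_quot U) : set (prob U) := sval theta.

(* Main.v *)
(* Closeness of measures is turned into closeness of random variables. The unit interval with
   Lebesgue measure is atomless, so a variable [X] of law [mu] and a coupling of [mu] and [nu]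
   produce a variable [Y] of law [nu] for which [E (d(X,Y) /\ 1)] exceeds the cost of the coupling
   by as little as desired: refine the discretised law of [X] step by step and pass to the limit in
   the complete space [U]. The triangle inequality for [W] and the completeness of [W] follow
   without disintegration.
   If [mu ~ mu'], the isometry between the supports agrees on a finite net carrying most of the
   mass with a global isometry [g] of [U], so [mu'] is [W]-close to [g_# mu] and every [nu] can be
   moved along by [g]. Hence [inf_(nu in eta) W(mu,nu)] does not depend on [mu] in [theta], which
   gives [W_bar = dist_W = W_H] and the description of the quotient topology.
   Classes at distance 0 coincide: if [(g_n)_# nu] tends to [mu], the orbit [(g_n x)_n] of a point
   [x] of the support of [nu] is totally bounded, and the limit of [g_n] along an ultrafilter is an
   isometry of supports which pushes [nu] to [mu].
   The segment [(1 - t) mu + t nu] has constant speed for [W], whence the length property. *)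
Require Import Defs.
From HB Require Import structures.
From mathcomp Require Import all_boot all_order all_algebra.
From mathcomp Require Import all_classical all_reals all_analysis.
From mathcomp Require Import measurable_realfun generic_quotient ring lra.

Set Implicit Arguments.
Unset Strict Implicit.
Unset Printing Implicit Defensive.

Import Order.TTheory GRing.Theory Num.Theory.
Import numFieldNormedType.Exports.

Local Open Scope classical_set_scope.
Local Open Scope ring_scope.

(** * The truncated distance and Borel measurability *)

(** Two obstacles shape the order of the lemmas. The limit law in the transport step has to be
    identified before the triangle inequality, which is deduced from that step; so equality of
    measures is first obtained from closed sets and an intermediate measure. Moreover an isometry
    between supports is controlled on the support only, so finite nets are taken inside the support
    and maps between supports are completed by the base point outside. Truncating the distance at 1
    makes a bad set cost at most its mass, so finitely many balls carrying most of the mass suffice,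
    although nothing is compact. Below the level 1 the truncation is invisible, which explains the
    minima with 1. Separability comes from the same picture: step functions on the unit interval
    with finitely many rational breakpoints and values in a dense sequence form a countable family,
    and their laws are dense. *)

Section metric_facts.
Context {R : realType} {U : metricType R}.
Implicit Types x y z : U.

Definition rho x y : R := Num.min (mdist x y) 1.

Lemma rho_ge0 x y : 0 <= rho x y.
Proof. by rewrite le_min mdist_ge0 ler01. Qed.

Lemma rho_le1 x y : rho x y <= 1.
Proof. by rewrite ge_min lexx orbT. Qed.

Lemma rho_le x y : rho x y <= mdist x y.
Proof. by rewrite ge_min lexx. Qed.

Lemma rhoxx x : rho x x = 0.
Proof. by rewrite /rho mdistxx min_l. Qed.

Lemma rhoC x y : rho x y = rho y x.
Proof. by rewrite /rho metric_sym. Qed.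

Lemma rho_triangle y x z : rho x z <= rho x y + rho y z.
Proof.
have := metric_triangle x y z; have := mdist_ge0 x y; have := mdist_ge0 y z.
rewrite /rho /Num.min; do 3 case: ifP; move=> /= *; lra.
Qed.

Lemma exists_natSinv_lt_half (e : R) : 0 < e -> exists n, n.+1%:R^-1 < e / 2.
Proof.
move=> e0; have := near_infty_natSinv_lt (PosNum (divr_gt0 e0 (ltr0n R 2))).
by move=> [N _ /(_ N (leqnn _)) /= h]; exists N.
Qed.

Lemma half_pow_lt (c : R) : 0 < c -> exists N, forall n, (N <= n)%N -> 2^-1 ^+ n < c.
Proof.
move=> c0; have /cvgrPdist_lt/(_ c c0)[N _ NP] : (2^-1 ^+ n : R) @[n --> \oo] --> (0 : R).
  by apply: cvg_expr; rewrite ger0_norm ?invf_lt1// ?ltr1n// invr_ge0.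
exists N => n /NP /=; rewrite sub0r normrN; apply: le_lt_trans; exact: ler_norm.
Qed.

Lemma open_mdistP (A : set U) :
  open A <-> forall x, A x -> exists2 e : R, 0 < e & forall y, mdist x y < e -> A y.
Proof.
rewrite openE; split=> h x /h.
  rewrite /interior -nbhs_ballE => -[e/= e0 eA]; exists e => // y xy.
  by apply: eA; rewrite ballEmdist.
move=> [e e0 eA]; rewrite /interior -nbhs_ballE; exists e => //= y.
by rewrite ballEmdist => /eA.
Qed.

Lemma open_mdist x (e : R) : open [set y | mdist x y < e].
Proof.
apply/open_mdistP => y /= xy; exists (e - mdist x y); first by rewrite subr_gt0.
move=> z yz; have := metric_triangle x y z; lra.
Qed.

Lemma cvgn_mdistP (u : nat -> U) (l : U) :
  u n @[n --> \oo] --> l <->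
  forall e : R, 0 < e -> exists N, forall n, (N <= n)%N -> mdist l (u n) < e.
Proof.
split=> [ul e e0|h].
  have /ul : @nbhs U U l [set y | mdist l y < e].
    by rewrite -nbhs_ballE; exists e => //= y; rewrite ballEmdist.
  by move=> [N _ NP]; exists N => n Nn; exact: (NP n).
move=> A; rewrite -nbhs_ballE => -[e/= e0 eA]; have [N NP] := h _ e0.
by exists N => // n /= Nn; apply: eA; rewrite ballEmdist; exact: NP.
Qed.

Definition dense_seq (a : nat -> U) :=
  forall x (e : R), 0 < e -> exists i, mdist x (a i) < e.

Lemma complete_seq : complete_metric U -> forall u : nat -> U,
  (forall e : R, 0 < e -> exists N, forall n, (N <= n)%N -> mdist (u N) (u n) < e) ->
  exists l : U, u n @[n --> \oo] --> l.
Proof.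
move=> cU u uC; apply: (cU (u n @[n --> \oo])).
apply: cauchy_exP => e e0; have [N NP] := uC _ e0; exists (u N), N => // n /= Nn.
by rewrite ballEmdist; exact: NP.
Qed.

End metric_facts.

Lemma separable_dense_seq {R : realType} {U : pmetricType R} :
  separable_metric U -> exists a : nat -> U, dense_seq a.
Proof.
move=> [D cD dD].
have near x (e : R) : 0 < e -> exists2 y, D y & mdist x y < e.
  move=> e0; have [||y [/= xy Dy]] := dD [set y | mdist x y < e].
  - by exists x; rewrite /= mdistxx.
  - exact: open_mdist.
  - by exists y.
have [f fi] := countable_injP _ cD.
have [d Dd _] := near point 1 ltr01.
exists (fun n => xget d [set y | D y /\ f y = n]) => x e e0.
have [y Dy xy] := near x e e0; exists (f y).
case: xgetP => [z _ [Dz /fi]|/(_ y)]; last by move=> /(_ (conj Dy erefl)).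
by rewrite !inE => ->.
Qed.

Section borel_facts.

Lemma open_borel (V : ptopologicalType) (A : set V) :
  open A -> measurable (A : set (borel V)).
Proof. by move=> oA; apply: sub_sigma_algebra. Qed.

Lemma closed_borel (V : ptopologicalType) (A : set V) :
  closed A -> measurable (A : set (borel V)).
Proof.
by move=> cA; rewrite -(setCK A); apply: measurableC; apply: open_borel; exact: closed_openC.
Qed.

Lemma borel_fun d (T : measurableType d) (V : ptopologicalType) (X : T -> V) :
  (forall A : set V, open A -> measurable (X @^-1` A)) ->
  measurable_fun [set: T] (X : T -> borel V).
Proof.
move=> h; apply: (@measurability _ _ T (borel V) setT _ (@open V)) => //.
by move=> _ [A oA <-]; rewrite setTI; exact: h.
Qed.

Lemma continuous_borel (V V' : ptopologicalType) (f : V -> V') :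
  continuous f -> measurable_fun [set: borel V] (f : borel V -> borel V').
Proof.
move=> /continuousP fc; apply: borel_fun => A /fc; exact: open_borel.
Qed.

Lemma fiber_measurable d (T : measurableType d) (Z : T -> nat) :
  (forall n, measurable [set w | Z w = n]) -> forall A : set nat, measurable (Z @^-1` A).
Proof.
move=> mZ A; rewrite (_ : _ @^-1` _ = \bigcup_n ([set w | Z w = n] `&` [set w | A n])).
  apply: bigcupT_measurable => n; apply: measurableI => //.
  by have [An|nAn] := pselect (A n); [rewrite (_ : mkset _ = setT)|rewrite (_ : mkset _ = set0)];
    rewrite // ; apply/seteqP; split=> // x.
by apply/seteqP; split=> [w /= Aw|w [n _ [/= <-]]//]; exists (Z w).
Qed.

End borel_facts.

Section rho_measurable.
Context {R : realType} {U : pmetricType R}.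
Variables (a : nat -> U) (aD : dense_seq a).

(* Separability makes every open subset of [U * U] a countable union of products of balls. *)
Lemma open_prod_bigcup (O : set (U * U)) : open O ->
  exists I : set (nat * nat * nat),
    O = \bigcup_(k in I) ([set x | mdist (a k.1.1) x < k.2.+1%:R^-1] `*`
                          [set y | mdist (a k.1.2) y < k.2.+1%:R^-1]).
Proof.
move=> oO.
exists [set k | [set x | mdist (a k.1.1) x < k.2.+1%:R^-1] `*`
   [set y | mdist (a k.1.2) y < k.2.+1%:R^-1] `<=` O].
apply/seteqP; split=> [[x y] Oxy|[x y] [k /= kO kxy]]; last exact: kO.
move: oO; rewrite openE => /(_ _ Oxy); rewrite /interior -nbhs_ballE => -[e /= e0 eO].
have [n ne] := exists_natSinv_lt_half e0.
have n0 : (0 : R) < n.+1%:R^-1 by rewrite invr_gt0.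
have [i xi] := aD x n0; have [j yj] := aD y n0.
exists (i, j, n); last by split; rewrite /= metric_sym.
move=> [x' y'] [/= xi' yj']; apply: eO; split=> /=; rewrite ballEmdist /=.
  have := metric_triangle x (a i) x'.
  by move: xi xi' ne; move: (n.+1%:R^-1) => t *; lra.
have := metric_triangle y (a j) y'.
by move: yj yj' ne; move: (n.+1%:R^-1) => t *; lra.
Qed.

Lemma pair_borel d (T : measurableType d) (X Y : T -> U) :
  measurable_fun [set: T] (X : T -> borel U) ->
  measurable_fun [set: T] (Y : T -> borel U) ->
  measurable_fun [set: T] ((fun w => (X w, Y w)) : T -> borel (U * U)%type).
Proof.
move=> mX mY; apply: borel_fun => O /open_prod_bigcup[I ->].
rewrite preimage_bigcup bigcup_mkcond; apply: countable_bigcupT_measurable => [|k].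
  exact: countableP.
case: ifP => // _.
rewrite (_ : _ @^-1` _ = (X @^-1` [set x | mdist (a k.1.1) x < k.2.+1%:R^-1]) `&`
    (Y @^-1` [set y | mdist (a k.1.2) y < k.2.+1%:R^-1])) //.
apply: measurableI.
  by rewrite -[X in measurable X]setTI; apply: mX => //; apply: open_borel; exact: open_mdist.
by rewrite -[X in measurable X]setTI; apply: mY => //; apply: open_borel; exact: open_mdist.
Qed.

Lemma fst_borel : measurable_fun setT (fst : borel (U * U)%type -> borel U).
Proof. by apply: continuous_borel => z; exact: cvg_fst. Qed.

Lemma snd_borel : measurable_fun setT (snd : borel (U * U)%type -> borel U).
Proof. by apply: continuous_borel => z; exact: cvg_snd. Qed.

Lemma mdist_lt_borel (c : R) :
  measurable ([set z | mdist z.1 z.2 < c] : set (borel (U * U)%type)).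
Proof.
apply: open_borel; rewrite openE => -[x y] /= xy.
rewrite /interior -nbhs_ballE; exists ((c - mdist x y) / 2) => /=.
  by rewrite divr_gt0// subr_gt0.
move=> [x' y'] [/=]; rewrite !ballEmdist /= => xx' yy'.
have := metric_triangle x' x y'; have := metric_triangle x y y'.
have := metric_sym x x'; lra.
Qed.

Lemma measurable_rho d (T : measurableType d) (X Y : T -> U) :
  measurable_fun [set: T] (X : T -> borel U) ->
  measurable_fun [set: T] (Y : T -> borel U) ->
  measurable_fun [set: T] (fun w => rho (X w) (Y w)).
Proof.
move=> mX mY; apply: measurable_minr; last exact: measurable_cst.
apply: (measurability _ (RGenCInfty.measurableE R)) => _ [_ [c ->] <-].
rewrite setTI -[X in measurable X]setCK; apply: measurableC.
have := pair_borel mX mY measurableT (mdist_lt_borel c); rewrite setTI.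
congr measurable; apply/seteqP; split=> w /=; rewrite in_itv /= andbT.
  by move=> h; apply/negP; rewrite -ltNge.
by move/negP; rewrite -ltNge.
Qed.

End rho_measurable.

(** * Couplings given by random variables *)

Definition law d (T : measurableType d) (R : realType) (P : probability T R)
    (V : ptopologicalType) (X : T -> V)
    (mX : measurable_fun [set: T] (X : T -> borel V)) : borel_prob R V :=
  distribution P (mfun_Sub (mem_set mX) : {mfun T >-> borel V}).

(** Agreement is asked on Borel sets only: a [probability] is also a function on the other subsets,
    so an equality with [law P mX] would be too strong. *)
Definition has_law d (T : measurableType d) (R : realType) (P : probability T R)
    (U : pmetricType R) (X : T -> U) (mu : borel_prob R U) :=
  measurable_fun [set: T] (X : T -> borel U) /\
  forall A : set U, measurable (A : set (borel U)) -> P (X @^-1` A) = mu A.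

Definition Erho d (T : measurableType d) (R : realType) (P : probability T R)
    (U : pmetricType R) (X Y : T -> U) : \bar R :=
  (\int[P]_(w in [set: T]) (rho (X w) (Y w))%:E)%E.

Section expectation.
Context {R : realType} {U : pmetricType R}.
Variables (a : nat -> U) (aD : dense_seq a).
Context d (T : measurableType d) (P : probability T R).
Local Open Scope ereal_scope.
Local Notation bmeas X := (measurable_fun [set: T] (X : T -> borel U)).
Implicit Types X Y Z : T -> U.

Lemma measurable_Erho X Y : bmeas X -> bmeas Y ->
  measurable_fun [set: T] (fun w => (rho (X w) (Y w))%:E).
Proof. by move=> mX mY; apply/measurable_EFinP; exact: (measurable_rho aD). Qed.

Lemma ErhoC X Y : Erho P X Y = Erho P Y X.
Proof. by apply: eq_integral => w _; rewrite rhoC. Qed.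

Lemma Erho_triangle Y X Z : bmeas X -> bmeas Y -> bmeas Z ->
  Erho P X Z <= Erho P X Y + Erho P Y Z.
Proof.
move=> mX mY mZ; rewrite /Erho -ge0_integralD//; first last.
- exact: measurable_Erho.
- by move=> w _; rewrite lee_fin rho_ge0.
- exact: measurable_Erho.
- by move=> w _; rewrite lee_fin rho_ge0.
apply: ge0_le_integral => //.
- by move=> w _; rewrite lee_fin rho_ge0.
- exact: measurable_Erho.
- by apply: emeasurable_funD; exact: measurable_Erho.
- by move=> w _; rewrite -EFinD lee_fin rho_triangle.
Qed.

(** As [rho] is at most 1, the integrand is below [c] plus the indicator of [D]. *)
Lemma Erho_le_set X Y (D : set T) (c : R) : bmeas X -> bmeas Y -> measurable D -> (0 <= c)%R ->
  (forall w, ~ D w -> (rho (X w) (Y w) <= c)%R) -> Erho P X Y <= c%:E + P D.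
Proof.
move=> mX mY mD c0 h.
apply: (@le_trans _ _ (\int[P]_(w in [set: T]) (c%:E + (\1_D w)%:E))).
  apply: ge0_le_integral => //.
  - by move=> w _; rewrite lee_fin rho_ge0.
  - exact: measurable_Erho.
  - apply: emeasurable_funD; first exact: measurable_cst.
    by apply/measurable_EFinP; exact: measurable_indic.
  move=> w _; rewrite -EFinD lee_fin indicE; have [wD|/negP wD] := boolP (w \in D).
    by apply: le_trans (rho_le1 _ _) _; rewrite /= lerDr.
  by rewrite addr0; apply: h => Dw; apply: wD; exact: mem_set.
rewrite ge0_integralD//; last by apply/measurable_EFinP; exact: measurable_indic.
rewrite integral_cst// integral_indic// setIT.
by rewrite [X in (_ * X + _)](_ : _ = 1) ?mule1//; exact: probability_setT.
Qed.

Lemma Erho_le X Y (c : R) : bmeas X -> bmeas Y ->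
  (forall w, (rho (X w) (Y w) <= c)%R) -> Erho P X Y <= c%:E.
Proof.
move=> mX mY h; rewrite -[leRHS]adde0 -(measure0 P); apply: Erho_le_set => //.
(* The constant is nonnegative because the bound holds at the base point of [T]. *)
by apply: le_trans (h point); exact: rho_ge0.
Qed.

Lemma Erho_le1 X Y : bmeas X -> bmeas Y -> Erho P X Y <= 1.
Proof. by move=> mX mY; apply: Erho_le => // w; exact: rho_le1. Qed.

Lemma lawP X (mX : bmeas X) : has_law P X (law P mX).
Proof. by []. Qed.

(** The joint law of [(X, Y)] is a coupling; this is how random variables on any probability space
    give upper bounds on [Wass]. *)
Lemma Wass_le_Erho X Y (mu nu : borel_prob R U) :
  has_law P X mu -> has_law P Y nu -> Wass mu nu <= Erho P X Y.
Proof.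
move=> [mX Xmu] [mY Ynu]; apply: ereal_inf_lbound.
have mXY := pair_borel aD mX mY.
exists (law P mXY).
  by move=> A mA; split; [rewrite -Xmu|rewrite -Ynu].
rewrite ge0_integral_distribution//=.
- apply/measurable_EFinP; apply: (measurable_rho aD).
    exact: fst_borel.
  exact: snd_borel.
- by move=> z; rewrite lee_fin rho_ge0.
Qed.

End expectation.

Section wasserstein.
Context {R : realType} {U : pmetricType R}.
Variables (a : nat -> U) (aD : dense_seq a).
Local Open Scope ereal_scope.
Implicit Types mu nu : borel_prob R U.

Lemma Wass_ge0 mu nu : 0 <= Wass mu nu.
Proof.
apply: le_ereal_inf_tmp => _ [pi _ <-]; apply: integral_ge0 => z _.
by rewrite lee_fin rho_ge0.
Qed.

Lemma Adm_fst mu nu pi : Adm mu nu pi -> has_law pi (fst : _ -> U) mu.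
Proof. by move=> h; split; [exact: fst_borel|move=> A /h[]]. Qed.

Lemma Adm_snd mu nu pi : Adm mu nu pi -> has_law pi (snd : _ -> U) nu.
Proof. by move=> h; split; [exact: snd_borel|move=> A /h[]]. Qed.

Lemma Wass_lt mu nu (e : \bar R) : Wass mu nu < e ->
  exists2 pi : borel_prob R (U * U)%type, Adm mu nu pi &
    Erho pi (fst : _ -> U) (snd : _ -> U) < e.
Proof. by move=> /ereal_inf_lt[_ [pi h <-] ?]; exists pi. Qed.

Lemma Wass_sym mu nu : Wass mu nu = Wass nu mu.
Proof.
wlog suff : mu nu / Wass mu nu <= Wass nu mu.
  by move=> h; apply/eqP; rewrite eq_le !h.
apply: le_ereal_inf_tmp => _ [pi h <-].
rewrite -/(Erho pi (fst : _ -> U) (snd : _ -> U)) ErhoC.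
by apply: (Wass_le_Erho aD); [exact: (Adm_snd h)|exact: (Adm_fst h)].
Qed.

Lemma has_law_id mu : has_law mu (idfun : borel U -> U) mu.
Proof. by split=> //; exact: measurable_id. Qed.

Lemma Wassxx mu : Wass mu mu = 0.
Proof.
have h := has_law_id mu; apply/eqP; rewrite eq_le Wass_ge0 andbT.
apply: le_trans (Wass_le_Erho aD h h) _.
by apply: (Erho_le aD) => [||w]; [exact: h.1|exact: h.1|rewrite rhoxx].
Qed.

Definition thick (F : set U) (r : R) := [set y | exists2 x, F x & (mdist x y < r)%R].

Lemma thick_open F r : open (thick F r).
Proof.
apply/open_mdistP => y [x Fx xy]; exists (r - mdist x y)%R; first by rewrite subr_gt0.
by move=> z yz; exists x => //; have := metric_triangle x y z; lra.
Qed.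

Lemma thick_thick F r s : thick (thick F r) s `<=` thick F (r + s).
Proof.
by move=> z [y [x Fx xy] yz]; exists x => //; have := metric_triangle x y z; lra.
Qed.

(** Markov's inequality for a coupling of cost below [e * r]: the pairs with [rho] at least [r] have
    mass at most [e], and any other pair starting in [F] ends in [thick F r]. Since [r <= 1],
    comparing [rho] or [mdist] with [r] is the same. *)
Lemma Wass_thick mu nu (F : set U) (r e : R) :
  measurable (F : set (borel U)) -> (0 < r <= 1)%R -> Wass mu nu < (e * r)%:E ->
  mu F <= nu (thick F r) + e%:E.
Proof.
move=> mF /andP[r0 r1] /Wass_lt[pi hpi Ipi].
have [f1 f2] := Adm_fst hpi; have [s1 s2] := Adm_snd hpi.
have mth : measurable (thick F r : set (borel U)) by apply: open_borel; exact: thick_open.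
rewrite -f2// -s2//.
set B := [set z : borel (U * U)%type | r%:E <= `|(rho z.1 z.2)%:E|].
have mrho := measurable_Erho aD f1 s1.
have mB : measurable B.
  rewrite (_ : B = ~` [set z | mdist z.1 z.2 < r]%R).
    by apply: measurableC; exact: mdist_lt_borel.
  apply/seteqP; split=> z; rewrite /B /= lee_fin ger0_norm ?rho_ge0// le_min r1 andbT.
    by move=> rz; apply/negP; rewrite -leNgt.
  by move/negP; rewrite -leNgt.
have Be : pi B <= e%:E.
  have := le_integral_abse pi measurableT mrho r0; rewrite setTI -/B => H.
  have : r%:E * pi B <= (e * r)%:E.
    apply: le_trans H _; apply/ltW; apply: le_lt_trans Ipi.
    by rewrite /Erho; under eq_integral => z _ do rewrite gee0_abs ?lee_fin ?rho_ge0//.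
  have : pi B \is a fin_num by rewrite fin_num_measure.
  by case: (pi B) => // b _; rewrite -EFinM !lee_fin mulrC ler_pM2r.
apply: (@le_trans _ _ (pi ((snd @^-1` thick F r) `|` B))).
  apply: le_measure; rewrite ?inE//.
  - by rewrite -[X in measurable X]setTI; exact: f1.
  - by apply: measurableU => //; rewrite -[X in measurable X]setTI; exact: s1.
  - move=> [x y] /= Fx; have [xy|xy] := ltP (mdist x y) r; [left|right].
      by exists x.
    by rewrite /B /= lee_fin ger0_norm ?rho_ge0// le_min xy.
apply: (le_trans (measureU2 _ _ _)) => //.
  by rewrite -[X in measurable X]setTI; exact: s1.
exact: leeD.
Qed.

(** The factor 2 serves [closed_le_Wass], which thickens [F] twice by [n.+1%:R^-1], once on each
    side of the intermediate measure. *)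
Lemma cvg_thick mu (F : set U) : closed F ->
  mu (thick F (2 * n.+1%:R^-1)) @[n --> \oo] --> mu F.
Proof.
move=> cF.
have FE : F = \bigcap_n thick F (2 * n.+1%:R^-1).
  apply/seteqP; split=> [x Fx n _|x h].
    by exists x => //; rewrite mdistxx mulr_gt0.
  apply: contrapT => nFx.
  have /open_mdistP/(_ _ nFx)[e e0 he] := closed_openC cF.
  have [N Ne] := exists_natSinv_lt_half e0.
  have [y Fy yx] := h N I; apply: (he y) => //.
  rewrite metric_sym; apply: (lt_trans yx); move: Ne; move: (N.+1%:R^-1)%R => t ?; lra.
rewrite [X in _ --> mu X]FE.
apply: (@nonincreasing_cvg_mu _ _ _ mu (fun n => thick F (2 * n.+1%:R^-1))) => //.
- by rewrite ltey_eq fin_num_measure//; apply: open_borel; exact: thick_open.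
- by move=> n; apply: open_borel; exact: thick_open.
- by apply: bigcapT_measurable => n; apply: open_borel; exact: thick_open.
- move=> m n mn; apply/subsetPset => y [x Fx xy]; exists x => //.
  by apply: lt_le_trans xy _; rewrite ler_pM2l// lef_pV2 ?posrE// ler_nat ltnS.
Qed.

Lemma borel_prob_unique mu nu : (forall F, closed F -> mu F <= nu F) ->
  (forall F, closed F -> nu F <= mu F) ->
  forall A : set U, measurable (A : set (borel U)) -> mu A = nu A.
Proof.
move=> h1 h2 A mA.
apply: (@g_sigma_algebra_measure_unique _ R (borel U) (@open U) _ (fun=> setT)) => //.
- by move=> O oO; exact: open_borel.
- by move=> _; exact: openT.
- by rewrite bigcup_const.
- by move=> O O'; exact: openI.
- move=> O oO; have mO (m : borel_prob R U) : m O = 1 - m (~` O).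
    by rewrite -[in LHS](setCK O); apply: probability_setC; apply: measurableC; exact: open_borel.
  transitivity (1 - mu (~` O)); first exact: mO.
  transitivity (1 - nu (~` O)); last by apply/esym; exact: mO.
  by congr (1 - _); apply/eqP; rewrite eq_le h1 ?h2//; exact: open_closedC.
- by move=> _; rewrite ltey_eq fin_num_measure.
Qed.

(** The intermediate measure [k] stands in for the triangle inequality, whose proof depends on this
    lemma through [unif_transport]. *)
Lemma closed_le_Wass mu nu (F : set U) :
  (forall e : R, (0 < e)%R -> exists2 k, Wass mu k < e%:E & Wass k nu < e%:E) ->
  closed F -> mu F <= nu F.
Proof.
move=> h cF.
have mth r : measurable (thick F r : set (borel U)) by apply: open_borel; exact: thick_open.
have H := @cvg_thick nu F cF; have := cvge_to_ge H; apply; apply: nearW => n.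
apply/lee_addgt0Pr => e e0; set r : R := (n.+1%:R^-1)%R.
have r01 : (0 < r <= 1)%R by rewrite invr_gt0 ltr0n invf_le1 ?ltr0n// ler1n.
have [r0 _] := andP r01.
have [|k muk knu] := h (e / 2 * r)%R; first by rewrite mulr_gt0// divr_gt0.
have h1 := Wass_thick (closed_borel cF) r01 muk.
have h2 := Wass_thick (mth r) r01 knu.
apply: (le_trans h1); apply: (le_trans (leeD h2 (lexx _))).
rewrite -addeA -EFinD -splitr leeD2r//; apply: le_measure; rewrite ?inE//.
- by apply: open_borel; exact: thick_open.
- by move=> y /thick_thick; rewrite mulr_natl mulr2n.
Qed.

Lemma Wass_close_eq mu nu :
  (forall e : R, (0 < e)%R -> exists2 k, Wass mu k < e%:E & Wass k nu < e%:E) ->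
  forall A : set U, measurable (A : set (borel U)) -> mu A = nu A.
Proof.
move=> h; apply: borel_prob_unique => F cF; apply: closed_le_Wass => // e /h[k ? ?].
by exists k; rewrite Wass_sym.
Qed.

End wasserstein.

(** * Prescribed joint laws on the unit interval *)

Section probability_facts.
Context d (T : measurableType d) (R : realType) (P : probability T R).

Lemma prob_le (A B : set T) : measurable A -> measurable B -> A `<=` B -> (P A <= P B)%E.
Proof. by move=> mA mB AB; apply: le_measure; rewrite ?inE. Qed.

Lemma prob_fin (A : set T) : measurable A -> P A \is a fin_num.
Proof. exact: fin_num_measure. Qed.

Lemma prob_lty (A : set T) : measurable A -> (P A < +oo)%E.
Proof. by move=> mA; rewrite ltey_eq prob_fin. Qed.

End probability_facts.

Section countable_valued.
Local Open Scope ereal_scope.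
Context {R : realType}.

Lemma integral_fibers d (T : measurableType d) (P : probability T R)
    (Z : T -> nat) (f : nat -> \bar R) :
  (forall n, measurable [set w | Z w = n]) -> (forall n, 0 <= f n) ->
  \int[P]_(w in [set: T]) f (Z w) = \sum_(n <oo) f n * P [set w | Z w = n].
Proof.
move=> mZ f0.
have UZ : [set: T] = \bigcup_n [set w | Z w = n].
  by apply/seteqP; split=> // w _; exists (Z w).
rewrite UZ ge0_integral_bigcup//; last first.
- by move=> i j _ _ [w [/= <- <-]].
- rewrite -UZ => _ B mB; rewrite setTI.
  by rewrite (_ : _ @^-1` _ = Z @^-1` (f @^-1` B))//; exact: fiber_measurable.
apply: eq_eseriesr => n _; rewrite -integral_cst//.
by apply: eq_integral => w; rewrite inE /= => ->.
Qed.

(** The expectation of a function of two discrete variables depends on their joint law only, so a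
    cost on the unit interval can be computed on the space from which the joint law was copied. *)
Lemma integral_fibers2 d (T : measurableType d) (P : probability T R)
    d' (T' : measurableType d') (Q : probability T' R)
    (Z Z' : T -> nat) (W W' : T' -> nat) (f : nat -> nat -> \bar R) :
  (forall n, measurable [set w | Z w = n]) ->
  (forall n, measurable [set w | Z' w = n]) ->
  (forall n, measurable [set w | W w = n]) ->
  (forall n, measurable [set w | W' w = n]) ->
  (forall i j, P ([set w | Z w = i] `&` [set w | Z' w = j]) =
               Q ([set w | W w = i] `&` [set w | W' w = j])) ->
  (forall i j, 0 <= f i j) ->
  \int[P]_(w in [set: T]) f (Z w) (Z' w) = \int[Q]_(w in [set: T']) f (W w) (W' w).
Proof.
move=> mZ mZ' mW mW' PQ f0.
pose g n := if @unpickle (nat * nat)%type n is Some p then f p.1 p.2 else 0.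
have g0 n : 0 <= g n by rewrite /g; case: unpickle.
have gE i j : f i j = g (pickle (i, j)) by rewrite /g pickleK.
under eq_integral do rewrite gE; under [RHS]eq_integral do rewrite gE.
(* [pickle_inv] is [Some p] only on genuine codes, unlike [unpickle]; every other fiber of the
   encoded pair is thus empty. *)
have fE S (V V' : S -> nat) n : [set w | pickle (V w, V' w) = n] =
    if @pickle_inv (nat * nat)%type n is Some p
    then [set w | V w = p.1] `&` [set w | V' w = p.2] else set0.
  apply/seteqP; split=> w /=.
    by move=> <-; rewrite pickleK_inv.
  case E: pickle_inv => [[i j]|//] [/= -> ->].
  by have := @pickle_invK (nat * nat)%type n; rewrite /oapp E.
rewrite (@integral_fibers _ _ P (fun w => pickle (Z w, Z' w)) g)//; last first.
  by move=> n; rewrite fE; case: pickle_inv => // p; exact: measurableI.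
rewrite (@integral_fibers _ _ Q (fun w => pickle (W w, W' w)) g)//; last first.
  by move=> n; rewrite fE; case: pickle_inv => // p; exact: measurableI.
by apply: eq_eseriesr => n _; rewrite !fE; case: pickle_inv => [p|]; rewrite ?PQ ?measure0.
Qed.

(** With equal finite sums, no term can be strictly larger. In [unif_split] this turns inclusions of
    sets into equalities of masses. *)
Lemma nneseries_eq_terms (u v : nat -> \bar R) :
  (forall n, 0 <= u n) -> (forall n, u n <= v n) ->
  \sum_(n <oo) v n = \sum_(n <oo) u n -> \sum_(n <oo) u n < +oo ->
  forall n, v n = u n.
Proof.
move=> u0 uv vu uoo n; apply/eqP; rewrite eq_le uv andbT.
have v0 k : 0 <= v k by exact: le_trans (u0 k) (uv k).
have := vu; have := uoo; rewrite (@nneseriesD1 _ u n xpredT)// (@nneseriesD1 _ v n xpredT)//.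
have : \sum_(0 <= k <oo | xpredT k && (k != n)) u k <= \sum_(0 <= k <oo | xpredT k && (k != n)) v k.
  by apply: lee_nneseries => // k _; exact: uv.
have : 0 <= \sum_(0 <= k <oo | xpredT k && (k != n)) u k by exact: nneseries_ge0.
have := v0 n; have := u0 n.
move: (\sum_(0 <= k <oo | _) u k) (\sum_(0 <= k <oo | _) v k) (u n) (v n).
move=> [s| |] [t| |] [x| |] [y| |]//=; rewrite ?lee_fin ?lte_fin//.
by move=> ? ? ? ? _ [?]; lra.
Qed.

End countable_valued.

(** A measure on the whole line carried by [[0, 1]]: random variables are then total functions on
    [R], and rays can be used to cut sets. *)
Definition unif (R : realType) : set (measurableTypeR R) -> \bar R :=
  mrestr (@lebesgue_measure R) (measurable_itv (`[0, 1] : interval R)).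

HB.instance Definition _ (R : realType) := Measure.copy (@unif R)
  (mrestr (@lebesgue_measure R) (measurable_itv (`[0, 1] : interval R))).

Lemma unifT (R : realType) : @unif R setT = 1%E.
Proof. by rewrite /unif /mrestr setTI lebesgue_measure_itv /= lte01 oppr0 adde0. Qed.

HB.instance Definition _ (R : realType) :=
  Measure_isProbability.Build _ _ R (@unif R) (@unifT R).

Section splitting.
Context {R : realType}.
Local Notation P := (@unif R).
Implicit Types S : set R.

Lemma unif_itv (x y : R) : x <= y -> (P `]x, y] <= (y - x)%:E)%E.
Proof.
move=> xy; apply: (@le_trans _ _ (lebesgue_measure `]x, y])).
  by apply: le_measure; rewrite ?inE//; exact: measurableI.
by rewrite lebesgue_measure_itv /=; case: ifP => //= _; rewrite lee_fin subr_ge0.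
Qed.

(** The mass of [S] below [t] is nondecreasing and 1-Lipschitz in [t]. It grows from 0 at 0 to the
    mass of [S] at 1, and the intermediate value theorem gives [t]. *)
Lemma unif_ray S (s : R) : measurable S -> 0 <= s -> (s%:E <= P S)%E ->
  exists t, P (S `&` `]-oo, t]) = s%:E.
Proof.
move=> mS s0 sS.
pose F t := fine (P (S `&` `]-oo, t])).
have mray t : measurable (S `&` `]-oo, t]).
  exact: measurableI.
have FE t : P (S `&` `]-oo, t]) = (F t)%:E.
  by rewrite fineK//; apply: prob_fin; exact: mray.
have Fle x y : x <= y -> F x <= F y <= F x + (y - x).
  move=> xy; rewrite -2!lee_fin EFinD -!FE; apply/andP; split.
    apply: prob_le => //; first exact: mray.
      exact: mray.
    move=> z [Sz /=]; rewrite ?in_itv /= => zx.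
    by split=> //=; rewrite ?in_itv /= (le_trans zx).
  apply: le_trans (leeD (lexx _) (unif_itv xy)).
  apply: le_trans (measureU2 _ _ _) => //; last exact: mray.
  apply: prob_le; [exact: mray|apply: measurableU; [exact: mray|exact: measurable_itv]|].
  move=> z [Sz /=]; rewrite ?in_itv /= => zy.
  by have [zx|xz] := leP z x; [left|right]; rewrite /= ?in_itv //= ?xz.
have Fc : continuous F.
  move=> t; apply/cvgrPdist_le => e e0; near=> u.
  have : `|t - u| <= e by near: u; apply: cvgr_dist_le.
  apply: le_trans; have [tu|/ltW ut] := leP t u.
    have /andP[h1 h2] := Fle _ _ tu.
    by rewrite ler0_norm ?subr_le0// ler0_norm ?subr_le0//; lra.
  have /andP[h1 h2] := Fle _ _ ut.
  by rewrite ger0_norm ?subr_ge0// ger0_norm ?subr_ge0//; lra.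
have F0 : F 0 = 0.
  apply/eqP; rewrite eq_le; apply/andP; split; last by rewrite -lee_fin -FE.
  rewrite -lee_fin -FE; apply: (@le_trans _ _ (lebesgue_measure [set (0 : R)])).
    apply: le_measure; rewrite ?inE//.
      by apply: measurableI => //; exact: mray.
    move=> z [[_ /=]]; rewrite ?in_itv /= => z0 /andP[z0' _].
    by apply/eqP; rewrite eq_le z0 z0'.
  by rewrite lebesgue_measure_set1.
have F1 : (F 1)%:E = P S.
  rewrite -FE /P /unif /mrestr -setIA; congr (lebesgue_measure (S `&` _)).
  by apply/seteqP; split=> z /=; rewrite ?in_itv /=; [case|move=> /andP[-> ->]].
have [] := @IVT R F 0 1 s ler01.
- exact: continuous_subspaceT.
- have s1 : s <= F 1 by rewrite -lee_fin F1.
  by rewrite F0 ge_min s0 /= le_max s1 orbT.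
- by move=> t _ <-; exists t.
Unshelve. all: by end_near. Qed.

(* Atomlessness of [unif]: a discrete random variable can be refined to one with any prescribed
   compatible joint law. *)
Lemma unif_split (Z : R -> nat) (c : nat -> nat -> \bar R) :
  (forall n, measurable [set w | Z w = n]) -> (forall i j, 0 <= c i j)%E ->
  (forall i, \sum_(j <oo) c i j = P [set w | Z w = i])%E ->
  exists Z' : R -> nat, (forall n, measurable [set w | Z' w = n]) /\
    forall i j, P ([set w | Z w = i] `&` [set w | Z' w = j]) = c i j.
Proof.
move=> mZ c0 cZ.
pose sg i j := (\sum_(0 <= l < j) c i l)%E.
have sg0 i j : (0 <= sg i j)%E by exact: sume_ge0.
have sgP i j : (sg i j <= P [set w | Z w = i])%E by rewrite -cZ; exact: nneseries_lim_ge.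
have sgfin i j : sg i j \is a fin_num.
  rewrite ge0_fin_numE//; apply: le_lt_trans (sgP i j) _.
  apply: prob_lty; exact: mZ.
have sgS i j : (sg i j.+1 = sg i j + c i j)%E by rewrite /sg big_nat_recr.
have cfin i j : c i j \is a fin_num.
  rewrite ge0_fin_numE//; apply: le_lt_trans (_ : sg i j.+1 < +oo)%E.
    by rewrite sgS leeDr.
  by rewrite -ge0_fin_numE.
(* Each fiber of [Z] is cut by rays at the partial sums of [c i]; the slice between two consecutive
   cuts has mass [c i j]. *)
pose q i s := xget 0 [set t | P ([set w | Z w = i] `&` `]-oo, t]) = s].
pose E i s := [set w | Z w = i] `&` `]-oo, q i s].
have mE i s : measurable (E i s) by exact: measurableI.
have PE i j : P (E i (sg i j)) = sg i j.
  rewrite /E /q; case: xgetP => [t _ //|/= h]; exfalso.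
  have [||t ht] := @unif_ray [set w | Z w = i] (fine (sg i j)) (mZ i).
  - by rewrite fine_ge0.
  - by rewrite fineK.
  - by apply: (h t); rewrite ht fineK.
have Emono i j k : (j <= k)%N -> E i (sg i j) `<=` E i (sg i k).
  move=> jk.
  have sjk : (sg i j <= sg i k)%E by exact: lee_sum_nneg_natr.
  have [st|/ltW ts] := leP (q i (sg i j)) (q i (sg i k)).
    by move=> w [Zw]; rewrite /= ?in_itv /= => wt; split=> //=; rewrite ?in_itv /= (le_trans wt).
  (* The chosen thresholds are in the wrong order here, which forces the two masses to be equal;
     [E i] depends only on the mass, so the two sets are the same. *)
  suff -> : sg i j = sg i k by [].
  apply/eqP; rewrite eq_le sjk /= -PE -(PE i j); apply: prob_le; [exact: mE|exact: mE|].
  by move=> w [Zw]; rewrite /= ?in_itv /= => wt; split=> //=; rewrite ?in_itv /= (le_trans wt).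
pose D i j := E i (sg i j.+1) `\` E i (sg i j).
have mD i j : measurable (D i j) by exact: measurableD.
have PD i j : P (D i j) = c i j.
  have EI : E i (sg i j.+1) `&` E i (sg i j) = E i (sg i j).
    by apply: setIidr; exact: Emono.
  have mE1 := mE i (sg i j.+1); have mE0 := mE i (sg i j).
  rewrite measureD//; last exact: prob_lty.
  rewrite EI; transitivity (sg i j.+1 - sg i j)%E; first by congr (_ - _)%E; exact: PE.
  by rewrite sgS addeAC subee// add0e.
have Dinj i j k w : D i j w -> D i k w -> j = k.
  move=> [Ej1 Ej] [Ek1 Ek]; apply/eqP; rewrite eqn_leq; apply/andP; split; rewrite leqNgt.
    by apply/negP => kj; apply: Ej; exact: Emono Ek1.
  by apply/negP => kj; apply: Ek; exact: Emono Ej1.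
(* Points outside every slice get the value 0, so a joint fiber only contains its slice; comparing
   the sums over [j] shows that the excess has no mass. *)
pose Z' w := xget 0%N [set j | D (Z w) j w].
have DZ i j w : D i j w -> Z w = i /\ Z' w = j.
  move=> Dw; have Zw : Z w = i by move: Dw => [[+ _] _].
  split=> //; rewrite /Z' Zw; case: xgetP => [k _ /= Dk|/(_ j)//].
  exact: Dinj Dk Dw.
have mZ'S j : measurable [set w | Z' w = j.+1].
  rewrite (_ : mkset _ = \bigcup_i D i j.+1); first exact: bigcupT_measurable.
  apply/seteqP; split=> [w /=|w [i _ /DZ[]]//].
  by rewrite /Z'; case: xgetP => // k -> /= Dk <-; exists (Z w).
have mZ' n : measurable [set w | Z' w = n].
  case: n => //; rewrite (_ : mkset _ = ~` \bigcup_j [set w | Z' w = j.+1]).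
    by apply: measurableC; exact: bigcupT_measurable.
  apply/seteqP; split=> w /=; first by move=> Z0 [j _ /=]; rewrite Z0.
  by case E0: (Z' w) => [//|k] h; exfalso; apply: h; exists k.
have mZZ' i j : measurable ([set w | Z w = i] `&` [set w | Z' w = j]).
  by apply: measurableI; [exact: mZ|exact: mZ'].
exists Z'; split=> // i.
apply: nneseries_eq_terms => //.
- move=> j; rewrite -PD; apply: prob_le; [exact: mD|exact: mZZ'|].
  by move=> w /DZ.
- rewrite cZ -(@measure_semi_bigcup _ _ _ P).
  + congr P; apply/seteqP; split=> [w [j _ []]//|w /= Zw].
    by exists (Z' w).
  + by move=> j; exact: mZZ'.
  + by move=> j k _ _ [w [[_ <-] [_ <-]]].
  + by apply: bigcupT_measurable => j; exact: mZZ'.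
- by rewrite cZ; apply: prob_lty; exact: mZ.
Qed.

End splitting.

(** * Limits of random variables *)

Section limits.
Context {R : realType} {U : pmetricType R}.
Variables (a : nat -> U) (aD : dense_seq a).
Context d (T : measurableType d) (P : probability T R).
Local Notation bmeas X := (measurable_fun [set: T] (X : T -> borel U)).
Implicit Types X Y Z : T -> U.

Lemma borel_preimage X (A : set U) : bmeas X -> measurable (A : set (borel U)) ->
  measurable (X @^-1` A).
Proof. by move=> mX mA; rewrite -[X in measurable X]setTI; exact: mX. Qed.

Lemma borel_if (E : set T) X Y : measurable E -> bmeas X -> bmeas Y ->
  bmeas (fun w => if w \in E then X w else Y w).
Proof.
move=> mE mX mY; apply: borel_fun => A oA.
rewrite (_ : _ @^-1` _ = (E `&` X @^-1` A) `|` (~` E `&` Y @^-1` A)).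
  have mA : measurable (A : set (borel U)) by exact: open_borel.
  apply: measurableU; apply: measurableI => //; [|exact: measurableC|];
    exact: borel_preimage.
apply/seteqP; split=> w /=.
  by case: ifPn => [/set_mem|/negP wE ?]; [left|right; split=> // /mem_set].
by move=> [[/mem_set -> //]|[nE]]; case: ifPn => // /set_mem.
Qed.

Lemma borel_comp_nat (b : nat -> U) (Z : T -> nat) :
  (forall n, measurable [set w | Z w = n]) -> bmeas (b \o Z).
Proof. by move=> mZ; apply: borel_fun => A _; exact: (fiber_measurable mZ (b @^-1` A)). Qed.

(** An open set is exhausted by the closed sets [C m] of points at distance at least [m.+1%:R^-1]
    from its complement. The limit lies in [A] exactly when the sequence eventually stays in one of
    them. *)
Lemma borel_lim (Y : nat -> T -> U) (L : T -> U) : (forall n, bmeas (Y n)) ->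
  (forall w, Y n w @[n --> \oo] --> L w) -> bmeas L.
Proof.
move=> mY YL; apply: borel_fun => A oA.
pose C m := ~` thick (~` A) m.+1%:R^-1.
rewrite (_ : _ @^-1` _ = \bigcup_m \bigcup_N \bigcap_(k in [set k | (N <= k)%N]) (Y k @^-1` C m)).
  apply: bigcupT_measurable => m; apply: bigcupT_measurable => N.
  apply: bigcap_measurable; first by exists N => /=.
  move=> k _; apply: borel_preimage => //; apply: closed_borel.
  by apply: open_closedC; exact: thick_open.
apply/seteqP; split=> w /=.
  move=> ALw; have /open_mdistP/(_ _ ALw)[e e0 eA] := oA.
  have [m me] := exists_natSinv_lt_half e0.
  have [N NP] := (cvgn_mdistP _ _).1 (YL w) _ (divr_gt0 e0 (ltr0n R 2)).
  exists m => //; exists N => // k /= Nk [y nAy yY]; apply: nAy; apply: eA.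
  have := metric_triangle (L w) (Y k w) y; have := NP _ Nk.
  have := metric_sym y (Y k w); move: me yY; move: (m.+1%:R^-1) => t *; lra.
move=> [m _ [N _ h]]; apply: contrapT => nAL.
have m0 : (0 : R) < m.+1%:R^-1 by rewrite invr_gt0.
have [M MP] := (cvgn_mdistP _ _).1 (YL w) _ m0.
apply: (h (maxn N M)) => /=; first exact: leq_maxl.
by exists (L w) => //; apply: MP; exact: leq_maxr.
Qed.

(** The sum of the successive values of [rho] has finite expectation, hence is finite almost
    everywhere. There the sequence is Cauchy, and the tails of the sum dominate the distances to the
    limit. *)
Lemma Erho_complete (X : nat -> T -> U) (e : R) : complete_metric U -> 0 <= e ->
  (forall n, bmeas (X n)) ->
  (forall n, (Erho P (X n) (X n.+1) <= (e / (2 ^ n.+1)%:R)%:E)%E) ->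
  exists2 L : T -> U, bmeas L & forall n, (Erho P (X n) L <= (e / (2 ^ n)%:R)%:E)%E.
Proof.
move=> cU e0 mX Xe.
pose r n w := (rho (X n w) (X n.+1 w))%:E.
have r0 n w : (0 <= r n w)%E by rewrite lee_fin rho_ge0.
have mr n : measurable_fun setT (r n) by exact: (measurable_Erho aD).
pose S n w := (\sum_(i <oo) r (i + n)%N w)%E.
have mS n : measurable_fun setT (S n) by apply: ge0_emeasurable_sum.
have SE n w : S n w = (\sum_(n <= i <oo) r i w)%E by exact: nneseries_addn.
have S0 n w : (0 <= S n w)%E by exact: nneseries_ge0.
have IS n : (\int[P]_(w in setT) S n w <= (e / (2 ^ n)%:R)%:E)%E.
  rewrite integral_nneseries//.
  apply: le_trans (epsilon_trick0 xpredT (_ : 0 <= e / (2 ^ n)%:R)); last first.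
    by rewrite divr_ge0.
  apply: lee_nneseries => [i _ _|i _]; first exact: integral_ge0.
  apply: le_trans (Xe _) _; rewrite lee_fin -mulrA -invfM -natrM -expnD.
  by rewrite addnS addnC.
have rS m n w : (m <= n)%N -> ((rho (X m w) (X n w))%:E <= S m w)%E.
  move=> mn; apply: (@le_trans _ _ (\sum_(m <= i < n) r i w)%E).
    elim: n mn => [|n IH]; first by rewrite leqn0 => /eqP ->; rewrite big_geq// rhoxx.
    rewrite leq_eqVlt => /predU1P[->|mn]; first by rewrite big_geq// rhoxx.
    rewrite big_nat_recr//=; apply: le_trans (leeD (IH mn) (lexx _)).
    by rewrite -EFinD lee_fin rho_triangle.
  by rewrite SE; exact: nneseries_lim_ge.
pose E := [set w | (S 0%N w < +oo)%E].
have mE : measurable E.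
  have := emeasurable_fun_infty_o measurableT (mS 0%N) +oo%E.
  by rewrite setTI.
have XC w : E w -> exists l : U, X n w @[n --> \oo] --> l.
  move=> Ew; apply: (complete_seq cU) => c c0.
  (* A value of [rho] below 1 is the distance itself, hence the minimum with 1. *)
  have /fine_cvgP[_ /cvgrPdist_lt/(_ (Num.min c 1))] :
      (\sum_(N <= k <oo) r k w)%E @[N --> \oo] --> 0%:E.
    apply: nneseries_tail_cvg => //; apply: le_lt_trans Ew.
    by rewrite SE.
  rewrite lt_min c0 ltr01 => /(_ isT)[N _ /(_ N (leqnn _))] /=.
  rewrite sub0r normrN => SN; exists N => n Nn.
  have Sfin : S N w \is a fin_num.
    rewrite ge0_fin_numE//; apply: le_lt_trans Ew.
    rewrite !SE [leRHS](nneseries_split 0 N)// add0n leeDr//.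
    exact: sume_ge0.
  have : rho (X N w) (X n w) < Num.min c 1.
    rewrite -lte_fin; apply: le_lt_trans (rS _ _ w Nn) _.
    rewrite -(fineK Sfin) lte_fin; apply: le_lt_trans SN.
    by rewrite SE ler_norm.
  by rewrite /rho !lt_min !gt_min ltxx orbF => /andP[/orP[//|c1] d1]; exact: lt_trans d1 c1.
(* The condition [E w] forces the value [point] off [E] even where the sequence converges, so [L] is
   everywhere the limit of the variables replaced by [point] off [E]. *)
pose L w : U := xget (point : U) [set l : U | E w /\ X n w @[n --> \oo] --> l].
have LE w : E w -> X n w @[n --> \oo] --> L w.
  move=> Ew; rewrite /L; case: xgetP => [l _ []//|/= h].
  by have [l /(conj Ew)/h] := XC w Ew.
have mL : bmeas L.
  apply: (@borel_lim (fun n w => if w \in E then X n w else (point : U))).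
    by move=> n; apply: borel_if => //; exact: measurable_cst.
  move=> w; have [wE|/negP wE] := boolP (w \in E); first by apply: LE; exact: set_mem.
  rewrite (_ : L w = (point : U)); first exact: cvg_cst.
  by rewrite /L; case: xgetP => // l _ [/mem_set].
exists L => // n; apply: le_trans (IS n).
apply: ae_ge0_le_integral => //.
  by move=> w _; rewrite lee_fin rho_ge0.
  exact: (measurable_Erho aD).
exists (~` E); split; first exact: measurableC.
  have : P.-integrable setT (S 0%N).
    apply/integrableP; split=> //; apply: le_lt_trans (ltry (e / (2 ^ 0)%:R)).
    by under eq_integral => w _ do rewrite gee0_abs//; exact: IS.
  move=> /(integrable_ae measurableT)[N [mN PN NE]].
  apply/eqP; rewrite eq_le measure_ge0 andbT -PN.
  apply: prob_le => //; first exact: measurableC.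
  by move=> w nEw; apply: NE => /(_ I); rewrite ge0_fin_numE.
move=> w /= h Ew; apply: h => _; apply/lee_addgt0Pr => c c0.
have [M MP] := (cvgn_mdistP _ _).1 (LE w Ew) c c0.
apply: (@le_trans _ _ ((rho (X n w) (X (maxn n M) w))%:E + (rho (X (maxn n M) w) (L w))%:E)%E).
  by rewrite -EFinD lee_fin rho_triangle.
apply: leeD; first by apply: rS; exact: leq_maxl.
rewrite lee_fin rhoC; apply: le_trans (rho_le _ _) _; apply/ltW/MP; exact: leq_maxr.
Qed.

End limits.

(** * Realising a coupling on the unit interval *)

(** Dependent choice, with [G] the invariant of each stage and [J] the link between consecutive
    stages. *)
Lemma sequential_choice (T : Type) (G : nat -> T -> Prop) (J : nat -> T -> T -> Prop) (x0 : T) :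
  G 0%N x0 -> (forall k x, G k x -> exists2 y, G k.+1 y & J k x y) ->
  exists s : nat -> T, [/\ s 0%N = x0, forall k, G k (s k) & forall k, J k (s k) (s k.+1)].
Proof.
move=> G0 step.
have /choice[F FP] : forall p : nat * T, exists y, G p.1 p.2 -> G p.1.+1 y /\ J p.1 p.2 y.
  move=> [k x] /=.
  have [/step[y Gy Jy]|nG] := pselect (G k x); first by exists y.
  by exists x.
pose s := fix s k := if k is k'.+1 then F (k', s k') else x0.
have Gs k : G k (s k) by elim: k => [//|k IH]; exact: (FP (k, s k) IH).1.
by exists s; split=> // k; exact: (FP (k, s k) (Gs k)).2.
Qed.

Section fibers.
Local Open Scope ereal_scope.

Lemma fiber_measure_eq (R : realType) d (T : measurableType d) (P : probability T R)
    d' (T' : measurableType d') (Q : probability T' R) (Z : T -> nat) (W : T' -> nat) :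
  (forall n, measurable [set w | Z w = n]) -> (forall n, measurable [set w | W w = n]) ->
  (forall n, P [set w | Z w = n] = Q [set w | W w = n]) ->
  forall B : set nat, P (Z @^-1` B) = Q (W @^-1` B).
Proof.
have sum d0 (S : measurableType d0) (M : probability S R) (V : S -> nat) B :
    (forall n, measurable [set w | V w = n]) ->
    M (V @^-1` B) = \sum_(n <oo) M ([set w | V w = n] `&` [set w | B n]).
  move=> mV; have mVB n : measurable ([set w | V w = n] `&` [set w | B n]).
    apply: measurableI => //; have [Bn|nBn] := pselect (B n).
      by rewrite (_ : mkset _ = setT)//; apply/seteqP; split.
    by rewrite (_ : mkset _ = set0)//; apply/seteqP; split.
  rewrite -(@measure_semi_bigcup _ _ _ M)//.
  - by congr (M _); apply/seteqP; split=> [w /= Bw|w [n _ [/= <-]]//]; exists (V w).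
  - by move=> i j _ _ [w [[/= <- _] [/= <- _]]].
  - exact: bigcupT_measurable.
move=> mZ mW PQ B; rewrite !sum//; apply: eq_eseriesr => n _.
have [Bn|nBn] := pselect (B n).
  have BT (S : Type) : [set w : S | B n] = setT by apply/seteqP; split.
  by rewrite !BT !setIT.
have B0 (S : Type) : [set w : S | B n] = set0 by apply/seteqP; split.
by rewrite !B0 !setI0 !measure0.
Qed.

Lemma fiber_marginal (R : realType) d (T : measurableType d) (P : probability T R)
    (Z Z' : T -> nat) (i : nat) :
  (forall n, measurable [set w | Z w = n]) -> (forall n, measurable [set w | Z' w = n]) ->
  \sum_(j <oo) P ([set w | Z w = i] `&` [set w | Z' w = j]) = P [set w | Z w = i].
Proof.
move=> mZ mZ'; rewrite -(@measure_semi_bigcup _ _ _ P).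
- congr (P _); apply/seteqP; split=> [w [j _ []]//|w Zw].
  by exists (Z' w).
- by move=> j; exact: measurableI.
- by move=> j k _ _ [w [[_ <-] [_ <-]]].
- by apply: bigcupT_measurable => j; exact: measurableI.
Qed.

End fibers.

Section cells.
Context {R : realType} {U : pmetricType R}.
Variables (a : nat -> U) (aD : dense_seq a).

(** The index of the first ball of radius [e] around a point of the sequence that contains [x].
    Density and [0 < e] keep the default 0 from being reached. Indices are kept instead of points so
    that discretised variables take values in [nat]. *)
Definition cell (e : R) (x : U) : nat :=
  if pselect (exists i, mdist x (a i) < e) is left h then ex_minn h else 0%N.

Lemma cellP e x : 0 < e -> mdist x (a (cell e x)) < e.
Proof.
by rewrite /cell => /(aD x) h; case: pselect => // h'; case: (ex_minnP h').
Qed.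

Lemma cell_measurable e n : 0 < e -> measurable ([set x | cell e x = n] : set (borel U)).
Proof.
move=> e0; have mB i : measurable ([set x | mdist x (a i) < e] : set (borel U)).
  rewrite (_ : mkset _ = [set x | mdist (a i) x < e]); last first.
    by apply/seteqP; split=> x /=; rewrite metric_sym.
  by apply: open_borel; exact: open_mdist.
rewrite (_ : mkset _ = [set x | mdist x (a n) < e] `\`
    \bigcup_(i in [set i | (i < n)%N]) [set x | mdist x (a i) < e]).
  by apply: measurableD => //; exact: bigcup_measurable.
apply/seteqP; split=> x /=.
  move=> <-; split; first exact: cellP.
  rewrite /cell; case: pselect => [h|[]]; last exact: aD.
  case: (ex_minnP h) => m _ hm [i /= im /hm].
  by rewrite leqNgt im.
rewrite /cell => -[xn hn]; case: pselect => [h|[]]; last by exists n.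
case: (ex_minnP h) => m hm hmin; apply/eqP; rewrite eqn_leq hmin//= leqNgt.
by apply/negP => mn; apply: hn; exists m.
Qed.

Lemma comp_cell_measurable d (T : measurableType d) (X : T -> U) e n : 0 < e ->
  measurable_fun [set: T] (X : T -> borel U) -> measurable [set w | cell e (X w) = n].
Proof. by move=> e0 mX; exact: (borel_preimage mX (cell_measurable n e0)). Qed.

Lemma rho_cell e x : 0 < e -> rho x (a (cell e x)) <= e.
Proof. by move=> e0; apply: le_trans (rho_le _ _) _; exact/ltW/cellP. Qed.

End cells.

Section transport.
Context {R : realType} {U : pmetricType R}.
Variables (a : nat -> U) (aD : dense_seq a) (cU : complete_metric U).
Local Notation P := (@unif R).
Local Open Scope ereal_scope.
Implicit Types (mu nu : borel_prob R U) (X Y : R -> U).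

(** Only the laws of consecutive pairs of discretisations are prescribed, never those of longer
    tuples: the convergence criterion [Erho_complete] looks at consecutive distances only, and one
    splitting per stage provides them. *)
Lemma unif_transport X mu nu (pi : borel_prob R (U * U)%type) (e : R) :
  has_law P X mu -> Adm mu nu pi -> (0 < e)%R ->
  exists2 Y, has_law P Y nu &
    Erho P X Y <= Erho pi (fst : _ -> U) (snd : _ -> U) + e%:E.
Proof.
move=> [mX Xmu] hpi e0.
have [f1 f2] := Adm_fst hpi; have [s1 s2] := Adm_snd hpi.
(* The error is five times [e / 5]: one for discretising [X], two for discretising the coordinates
   of the coupling, and two for the passage from [Z 0] to the limit. *)
pose lev k := (e / 5 / 2 ^+ k)%R.
have lev0 k : (0 < lev k)%R by rewrite !divr_gt0// exprn_gt0.
have levS k : lev k = (2 * lev k.+1)%R.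
  by rewrite /lev exprS; field; rewrite expf_neq0.
pose q k := cell a (lev k).
have mq k n : measurable ([set x | q k x = n] : set (borel U)) by exact: cell_measurable.
have mqX k n d (T : measurableType d) (V : T -> U) :
    measurable_fun setT (V : T -> borel U) -> measurable [set w | q k (V w) = n].
  by move=> mV; exact: comp_cell_measurable.
have rq k x : (rho x (a (q k x)) <= lev k)%R by exact: rho_cell.
(* [(q 0%N \o X, Z1)] receives the joint law of [(q 0%N \o fst, q 1%N \o snd)] under [pi]. The
   masses are compatible because [X] and [fst] both have law [mu]. *)
have [Z1 [mZ1 Z1P]] := @unif_split R (fun w => q 0%N (X w))
  (fun i j => pi ([set z | q 0%N z.1 = i] `&` [set z | q 1%N z.2 = j]))
  (fun n => mqX _ _ _ _ _ mX) (fun i j => measure_ge0 _ _)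
  (fun i => etrans (@fiber_marginal _ _ _ pi (fun z => q 0%N z.1) (fun z => q 1%N z.2) i
     (fun n => mqX _ _ _ _ _ f1) (fun n => mqX _ _ _ _ _ s1))
     (etrans (f2 _ (mq 0%N i)) (esym (Xmu _ (mq 0%N i))))).
(* The levels are shifted by one: stage [k] imitates [q k.+1], since [Z1] already lives at level
   1. *)
pose G k (Z : R -> nat) := (forall n, measurable [set w | Z w = n]) /\
  forall n, P [set w | Z w = n] = nu [set x | q k.+1 x = n].
pose J k (Z Z' : R -> nat) := forall i j, P ([set w | Z w = i] `&` [set w | Z' w = j]) =
  nu ([set x | q k.+1 x = i] `&` [set x | q k.+2 x = j]).
have [||Z [Z0 ZG ZJ]] := @sequential_choice _ G J Z1.
- split=> // n; rewrite -(s2 _ (mq _ _)).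
  transitivity (\sum_(i <oo) P ([set w | Z1 w = n] `&` [set w | q 0%N (X w) = i])).
    by rewrite fiber_marginal// => i; exact: mqX.
  rewrite -[RHS](@fiber_marginal _ _ _ pi (fun z => q 1%N z.2) (fun z => q 0%N z.1)).
  + by apply: eq_eseriesr => i _; rewrite setIC Z1P setIC.
  + by move=> i; exact: mqX.
  + by move=> i; exact: mqX.
- move=> k Z [mZ ZP].
  have [Z' [mZ' Z'P]] := @unif_split R Z
    (fun i j => nu ([set x | q k.+1 x = i] `&` [set x | q k.+2 x = j])) mZ
    (fun i j => measure_ge0 _ _)
    (fun i => etrans (@fiber_marginal _ _ _ nu _ _ i (mq _) (mq _)) (esym (ZP i))).
  exists Z' => //; split=> // n; rewrite -(@fiber_marginal _ _ _ P Z' Z)//.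
  rewrite -(@fiber_marginal _ _ _ nu (q k.+2) (q k.+1))//.
  by apply: eq_eseriesr => i _; rewrite setIC; apply: etrans (Z'P _ _) _; rewrite setIC.
have mZ k := (ZG k).1.
have ra0 i j : 0 <= (rho (a i) (a j))%:E by rewrite lee_fin rho_ge0.
have mY k : measurable_fun setT (a \o Z k : R -> borel U) by exact: borel_comp_nat.
have mr k : measurable_fun setT (a \o q k : borel U -> borel U) by exact: borel_comp_nat.
have mid : measurable_fun setT (idfun : borel U -> borel U) by exact: measurable_id.
have [|||L mL LP] := @Erho_complete R U a aD _ _ P (fun k => a \o Z k) (2 * (e / 5)) cU.
- by rewrite mulr_ge0// divr_ge0// ltW.
- exact: mY.
- move=> k; rewrite /Erho /=.
  rewrite (@integral_fibers2 _ _ _ P _ _ nu (Z k) (Z k.+1) (q k.+1) (q k.+2)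
    (fun i j => (rho (a i) (a j))%:E) (mZ k) (mZ k.+1) (mq _) (mq _) (ZJ k) ra0).
  apply: (@Erho_le _ _ _ aD _ _ nu (a \o q k.+1) (a \o q k.+2)) => // x.
  apply: le_trans (rho_triangle x _ _) _; rewrite rhoC.
  apply: le_trans (lerD (rq _ _) (rq _ _)) _.
  rewrite natrX -mulrA -/(lev k.+1) mulr_natl mulr2n lerD2l (levS k.+1) ler_peMl ?ler1n//.
  exact: ltW.
exists L.
  split=> // A mA.
  have hk k : has_law nu (a \o q k.+1) (law P (mY k)).
    split=> // B mB.
    exact: (esym (@fiber_measure_eq R _ _ P _ _ nu _ _ (mZ k) (mq k.+1) (ZG k).2 (a @^-1` B))).
  suff : forall A : set U, measurable (A : set (borel U)) -> law P mL A = nu A by apply.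
  (* The intermediate measure is the law of [a \o Z k]: close to the law of [L] by the rate of
     convergence, and close to [nu] because it is also the law of [a \o q k.+1] under [nu]. *)
  apply: (Wass_close_eq aD) => // c c0.
  have [k kc] : exists k, (2 * (e / 5) / 2 ^+ k < c)%R.
    have e50 : (0 < 2 * (e / 5))%R by rewrite mulr_gt0// divr_gt0.
    have [k /(_ k (leqnn k))] := half_pow_lt (divr_gt0 c0 e50).
    by rewrite ltr_pdivlMr// exprVn mulrC; exists k.
  exists (law P (mY k)).
    rewrite (Wass_sym aD); apply: le_lt_trans (Wass_le_Erho aD (lawP P (mY k)) (lawP P mL)) _.
    by apply: le_lt_trans (LP k) _; rewrite natrX lte_fin.
  rewrite (Wass_sym aD); apply: le_lt_trans (Wass_le_Erho aD (has_law_id nu) (hk k)) _.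
  apply: le_lt_trans
    (@Erho_le R U a aD _ _ nu idfun (a \o q k.+1) (lev k.+1) mid (mr _) (rq _)) _.
  rewrite lte_fin.
  by apply: le_lt_trans kc; rewrite -mulrA -/(lev k) (levS k) mulrA ler_peMl// ?ltW//; lra.
have m0 : measurable_fun setT (a \o (q 0%N \o X) : R -> borel U).
  by apply: borel_comp_nat => n; exact: mqX.
have b1 : Erho P X (a \o (q 0%N \o X)) <= (e / 5)%:E.
  by apply: (Erho_le aD) => // w; apply: le_trans (rq _ _) _; rewrite /lev expr0 divr1.
have b3 : Erho P (a \o Z 0%N) L <= (2 * (e / 5))%:E.
  by apply: le_trans (LP 0%N) _; rewrite expn0 divr1.
have shift (x y : R) (I : \bar R) : x%:E + (I + y%:E) = I + (x + y)%:E.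
  by rewrite addeCA EFinD.
set I := Erho pi _ _.
have b2 : Erho P (a \o (q 0%N \o X)) (a \o Z 0%N) <= I + (2 * (e / 5))%:E.
  rewrite /Erho /= Z0.
  rewrite (@integral_fibers2 _ _ _ P _ _ pi (q 0%N \o X) Z1 (q 0%N \o fst) (q 1%N \o snd)
    (fun i j => (rho (a i) (a j))%:E) (fun n => mqX _ _ _ _ _ mX) mZ1
    (fun n => mqX _ _ _ _ _ f1) (fun n => mqX _ _ _ _ _ s1) Z1P ra0).
  have m1 : measurable_fun setT (a \o (q 0%N \o fst) : borel (U * U)%type -> borel U).
    by apply: borel_comp_nat => n; exact: mqX.
  have m2 : measurable_fun setT (a \o (q 1%N \o snd) : borel (U * U)%type -> borel U).
    by apply: borel_comp_nat => n; exact: mqX.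
  have c1 : Erho pi (a \o (q 0%N \o fst)) (fst : _ -> U) <= (e / 5)%:E.
    apply: (Erho_le aD) => // w; rewrite rhoC; apply: le_trans (rq _ _) _.
    by rewrite /lev expr0 divr1.
  have c2 : Erho pi (snd : _ -> U) (a \o (q 1%N \o snd)) <= (e / 5)%:E.
    apply: (Erho_le aD) => // w; apply: le_trans (rq _ _) _.
    by have := levS 0%N; have := lev0 1%N; rewrite {2}/lev expr0 divr1; lra.
  apply: le_trans (Erho_triangle aD pi m1 f1 m2) _.
  apply: le_trans (leeD c1 (le_trans (Erho_triangle aD pi f1 s1 m2) (leeD (lexx I) c2))) _.
  by rewrite shift mulr_natl mulr2n.
apply: le_trans (Erho_triangle aD P mX m0 mL) _.
apply: le_trans (leeD b1 (le_trans (Erho_triangle aD P m0 (mY 0%N) mL) (leeD b2 b3))) _.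
by rewrite -[(I + _ + _)%E]addeA -EFinD shift leeD2l// lee_fin; lra.
Qed.

End transport.

(** * The truncated Wasserstein distance and supports *)

Section wasserstein_metric.
Context {R : realType} {U : pmetricType R}.
Variables (a : nat -> U) (aD : dense_seq a) (cU : complete_metric U).
Local Notation P := (@unif R).
Local Open Scope ereal_scope.
Implicit Types (mu nu la : borel_prob R U) (X Y : R -> U).

(** A constant variable is transported along the coupling of the Dirac mass at [point] with [mu]. *)
Lemma unif_law_exists mu : exists X, has_law P X mu.
Proof.
have mpt d (T : measurableType d) : measurable_fun setT ((fun=> point) : T -> borel U).
  exact: measurable_cst.
pose X0 : R -> U := fun=> point.
have mpair := pair_borel aD (mpt _ (borel U)) (@measurable_id _ (borel U) setT).
have hpi : Adm (law P (mpt _ R)) mu (law mu mpair).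
  move=> A mA; split=> //.
  change (mu (cst (point : U) @^-1` A) = P (cst (point : U) @^-1` A)).
  rewrite !preimage_cst; case: ifP => _; last by rewrite !measure0.
  by transitivity (1 : \bar R); [|apply/esym]; exact: probability_setT.
have [Y Ymu _] := unif_transport aD cU (lawP P (mpt _ R)) hpi ltr01.
by exists Y.
Qed.

Lemma Wass_le1 mu nu : Wass mu nu <= 1.
Proof.
have [X hX] := unif_law_exists mu; have [Y hY] := unif_law_exists nu.
apply: le_trans (Wass_le_Erho aD hX hY) _.
by apply: (Erho_le1 aD); [exact: hX.1|exact: hY.1].
Qed.

Lemma Wass_fin mu nu : Wass mu nu \is a fin_num.
Proof. by rewrite ge0_fin_numE ?Wass_ge0//; apply: le_lt_trans (Wass_le1 mu nu) (ltry 1). Qed.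

Lemma unif_near X mu nu (e : R) : has_law P X mu -> (0 < e)%R ->
  exists2 Y, has_law P Y nu & Erho P X Y <= Wass mu nu + e%:E.
Proof.
move=> hX e0; have e20 : (0 < e / 2)%R by rewrite divr_gt0.
have [|pi hpi Ipi] := @Wass_lt R U mu nu (Wass mu nu + (e / 2)%:E).
  by rewrite lteDl ?Wass_fin// lte_fin.
have [Y hY XY] := unif_transport aD cU hX hpi e20.
exists Y => //; apply: le_trans XY _; rewrite [in leRHS](splitr e) EFinD addeA leeD2r//.
exact: ltW.
Qed.

Lemma Wass_triangle nu mu la : Wass mu la <= Wass mu nu + Wass nu la.
Proof.
apply/lee_addgt0Pr => e e0; have e20 : (0 < e / 2)%R by rewrite divr_gt0.
have [X hX] := unif_law_exists mu.
have [Y hY XY] := unif_near nu hX e20.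
have [Z hZ YZ] := unif_near la hY e20.
apply: le_trans (Wass_le_Erho aD hX hZ) _.
apply: le_trans (Erho_triangle aD P hX.1 hY.1 hZ.1) _.
apply: le_trans (leeD XY YZ) _.
by rewrite addeACA -EFinD -splitr.
Qed.

Lemma Wass_complete (mu : nat -> borel_prob R U) (e : R) : (0 <= e)%R ->
  (forall n, Wass (mu n) (mu n.+1) < (e / (2 ^ n.+1)%:R)%:E) ->
  exists la, forall n, Wass (mu n) la <= (e / (2 ^ n)%:R)%:E.
Proof.
move=> e0 mue; have [X0 hX0] := unif_law_exists (mu 0%N).
have [|X [_ hX XX]] := @sequential_choice (R -> U) (fun n X => has_law P X (mu n))
  (fun n X Y => Erho P X Y <= (e / (2 ^ n.+1)%:R)%:E) X0 hX0.
  move=> n X hX; have := mue n.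
  (* The strict inequality leaves a gap, which pays for the error in [unif_near]. *)
  rewrite -[Wass _ _]fineK ?Wass_fin// lte_fin -subr_gt0 => d0.
  have [Y hY XY] := unif_near (mu n.+1) hX d0; exists Y => //.
  apply: le_trans XY _; rewrite -[Wass _ _]fineK ?Wass_fin// -EFinD lee_fin.
  by rewrite addrC subrK.
have [L mL LP] := Erho_complete aD cU e0 (fun n => (hX n).1) XX.
exists (law P mL) => n; apply: le_trans (LP n).
exact: (Wass_le_Erho aD (hX n) (lawP P mL)).
Qed.

Lemma Wass_eq0 mu nu : Wass mu nu = 0 ->
  forall A : set U, measurable (A : set (borel U)) -> mu A = nu A.
Proof.
move=> W0; apply: (Wass_close_eq aD) => e e0; exists mu.
  by rewrite (Wassxx aD) lte_fin.
by rewrite W0 lte_fin.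
Qed.

End wasserstein_metric.

Section supports.
Context {R : realType} {U : pmetricType R}.
Variables (a : nat -> U) (aD : dense_seq a) (cU : complete_metric U).
Local Open Scope ereal_scope.
Implicit Types (mu nu : borel_prob R U).

Lemma spt_ballP mu x : spt mu x <-> forall e : R, (0 < e)%R -> 0 < mu [set y | (mdist x y < e)%R].
Proof.
split=> [h e e0|h A oA Ax]; first by apply: h; [exact: open_mdist|rewrite /= mdistxx].
have [e e0 eA] := (open_mdistP A).1 oA x Ax.
apply: lt_le_trans (h e e0) _; apply: prob_le => //; apply: open_borel => //.
exact: open_mdist.
Qed.

Lemma sptPn mu x : ~ spt mu x ->
  exists2 e : R, (0 < e)%R & ~ 0 < mu [set y | (mdist x y < e)%R].
Proof.
move=> nx; apply: contrapT => h; apply/nx/spt_ballP => e e0.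
by apply: contrapT => h'; apply: h; exists e.
Qed.

Lemma spt_closed mu : closed (spt mu).
Proof.
rewrite -openC; apply/open_mdistP => x /= nx.
have [e e0 xe] := sptPn nx.
exists e => // y xy sy; apply: xe.
by apply: sy; [exact: open_mdist|].
Qed.

Lemma spt_borel mu : measurable (spt mu : set (borel U)).
Proof. by apply: closed_borel; exact: spt_closed. Qed.

(** By density of the sequence, the complement of the support is covered by countably many null
    balls [B (i, n)]. *)
Lemma spt_full mu : mu (~` spt mu) = 0.
Proof.
pose B (p : nat * nat) := [set y : U | (mdist (a p.1) y < p.2.+1%:R^-1)%R].
pose N p := if mu (B p) == 0 then B p else set0.
have mB p : measurable (B p : set (borel U)) by apply: open_borel; exact: open_mdist.
have mN p : measurable (N p : set (borel U)) by rewrite /N; case: ifP.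
have N0 p : mu (N p) = 0 by rewrite /N; case: ifPn => [/eqP|_]; rewrite ?measure0.
apply/eqP; rewrite eq_le measure_ge0 andbT.
pose F n := if @unpickle (nat * nat)%type n is Some p then N p else set0.
have mF n : measurable (F n : set (borel U)) by rewrite /F; case: unpickle.
have -> : ~` spt mu = \bigcup_n F n.
  apply/seteqP; split=> [x /= nx|x [n _]].
    have [e e0 xe] := sptPn nx.
    have [n ne] := exists_natSinv_lt_half e0.
    have n0 : (0 < n.+1%:R^-1 :> R)%R by rewrite invr_gt0.
    have [i xi] := aD x n0.
    exists (pickle (i, n)) => //; rewrite /F pickleK /N.
    have Bx : B (i, n) x by rewrite /B /= metric_sym.
    suff -> : mu (B (i, n)) == 0 by [].
    apply/eqP/le_anti; rewrite measure_ge0 andbT leNgt; apply/negP => B0; apply: xe.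
    apply: lt_le_trans B0 _; apply: prob_le => //; first by apply: open_borel; exact: open_mdist.
    move=> y; rewrite /B /= => iy; have := metric_triangle x (a i) y.
    by move: xi iy ne; move: (n.+1%:R^-1)%R => t *; lra.
  rewrite /F; case: unpickle => [p|//]; rewrite /N; case: ifPn => [/eqP B0 Bx|//] sx.
  by have := sx _ (open_mdist _ _) Bx; rewrite -/(B p) B0 ltxx.
apply: (@le_trans _ _ (\sum_(n <oo) mu (F n))).
  by apply: measure_sigma_subadditive => //; exact: bigcupT_measurable.
by rewrite eseries0// => n _ _; rewrite /F; case: unpickle.
Qed.

Lemma spt_setI mu (A : set U) : measurable (A : set (borel U)) -> mu (spt mu `&` A) = mu A.
Proof.
move=> mA; apply/eqP; rewrite eq_le; apply/andP; split.
  by apply: prob_le => //; first exact: measurableI (spt_borel mu) mA.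
have ms := spt_borel mu.
have -> : mu A = mu ((spt mu `&` A) `|` (~` spt mu `&` A)).
  by rewrite -setIUl setUv setTI.
apply: (le_trans (measureU2 _ _ _)); [exact: measurableI| |].
  by apply: measurableI => //; exact: measurableC.
rewrite -[leRHS]adde0 leeD2l// -(spt_full mu); apply: prob_le => //.
- by apply: measurableI => //; exact: measurableC.
- exact: measurableC.
Qed.

End supports.

(** * Equivalence of measures *)

Section equivalence.
Context {R : realType} {U : pmetricType R}.
Variables (a : nat -> U) (aD : dense_seq a) (cU : complete_metric U).
Local Open Scope ereal_scope.
Implicit Types (mu nu la : borel_prob R U).

Lemma isometry_borel (S : set U) (phi : U -> U) : measurable (S : set (borel U)) ->
  isometry_on S phi ->
  measurable_fun setT ((fun x => if x \in S then phi x else point) : borel U -> borel U).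
Proof.
move=> mS iphi; apply: borel_fun => A oA.
(* A union of balls centred in [S], each with the radius of a ball around the image of its centre
   that lies in [A]. It is open in [U], and its trace on [S] is the preimage of [A]. *)
pose O := [set y | exists x (e : R), [/\ S x, (0 < e)%R,
  forall z, (mdist (phi x) z < e)%R -> A z & (mdist x y < e)%R]].
have oO : open O.
  apply/open_mdistP => y [x [e [Sx e0 eA xy]]]; exists (e - mdist x y)%R.
    by rewrite subr_gt0.
  move=> z yz; exists x, e; split=> //.
  by have := metric_triangle x y z; lra.
rewrite (_ : _ @^-1` _ = (S `&` O) `|` (~` S `&` [set x : borel U | A point])).
  apply: measurableU; apply: measurableI => //; first exact: open_borel.
    exact: measurableC.
  have [Ap|nAp] := pselect (A point).
    by rewrite (_ : mkset _ = setT)//; apply/seteqP; split.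
  by rewrite (_ : mkset _ = set0)//; apply/seteqP; split.
apply/seteqP; split=> x /=.
  case: ifPn => [/set_mem Sx Ax|/negP xS Ap]; last by right; split=> // /mem_set.
  left; split=> //; have [e e0 eA] := (open_mdistP A).1 oA _ Ax.
  by exists x, e; split=> //; rewrite mdistxx.
move=> [[Sx [y [e [Sy e0 eA yx]]]]|[nSx Ap]].
  by rewrite mem_set//; apply: eA; rewrite iphi.
by case: ifPn => // /set_mem.
Qed.

Lemma spt_isometry_law mu nu (phi : U -> U) : isometry_on (spt mu) phi ->
  (forall A : set U, measurable (A : set (borel U)) -> mu (spt mu `&` phi @^-1` A) = nu A) ->
  has_law mu (fun x => if x \in spt mu then phi x else point) nu.
Proof.
move=> iphi h; have mphi := isometry_borel (spt_borel mu) iphi; split=> // A mA.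
rewrite -h// -(spt_setI aD)//; last exact: (borel_preimage mphi).
by congr (mu _); apply/seteqP; split=> x /= [sx]; rewrite ?mem_set.
Qed.

Lemma spt_preimage_borel mu (phi : U -> U) (A : set U) : isometry_on (spt mu) phi ->
  measurable (A : set (borel U)) -> measurable (spt mu `&` phi @^-1` A : set (borel U)).
Proof.
move=> iphi mA; have mphi := isometry_borel (spt_borel mu) iphi.
rewrite (_ : _ `&` _ = spt mu `&` (fun x => if x \in spt mu then phi x else point) @^-1` A).
  by apply: measurableI; [exact: spt_borel|exact: (borel_preimage mphi)].
by apply/seteqP; split=> x /= [sx]; rewrite ?mem_set.
Qed.

(* The isometric image of a support is complete, hence closed: it is the support of the image. *)
Lemma isometry_equiv mu nu (phi : U -> U) : isometry_on (spt mu) phi ->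
  (forall A : set U, measurable (A : set (borel U)) -> mu (spt mu `&` phi @^-1` A) = nu A) ->
  prob_equiv mu nu.
Proof.
move=> iphi h; exists phi; split=> //; split.
- move=> x sx A oA Ax; rewrite -h; last exact: open_borel.
  have [e e0 eA] := (open_mdistP A).1 oA _ Ax.
  have mB : measurable ([set y | (mdist x y < e)%R] : set (borel U)).
    by apply: open_borel; exact: open_mdist.
  apply: (@lt_le_trans _ _ (mu (spt mu `&` [set y | (mdist x y < e)%R]))).
    by rewrite (spt_setI aD)//; exact: ((spt_ballP mu x).1 sx).
  apply: prob_le.
  - by apply: measurableI => //; exact: spt_borel.
  - by apply: spt_preimage_borel => //; exact: open_borel.
  - by move=> y [sy xy]; split=> //; apply: eA; rewrite iphi.
- move=> x y /set_mem sx /set_mem sy xy; apply: mdist_positivity.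
  by rewrite -iphi// xy mdistxx.
- move=> y sy.
  have step n : exists x, spt mu x /\ (mdist y (phi x) < 2^-1 ^+ n)%R.
    have n0 : (0 < 2^-1 ^+ n :> R)%R by rewrite exprn_gt0// invr_gt0.
    have := (spt_ballP nu y).1 sy _ n0; rewrite -h; last first.
      by apply: open_borel; exact: open_mdist.
    move=> B0; apply: contrapT => nx; move: B0.
    rewrite (_ : _ `&` _ = set0) ?measure0 ?ltxx//; apply/seteqP; split=> // x [? ?].
    by apply: nx; exists x.
  have [x xP] := choice step.
  have [l xl] : exists l : U, x n @[n --> \oo] --> l.
    apply: complete_seq => // c c0.
    have [N NP] := half_pow_lt (divr_gt0 c0 (ltr0n R 2)); exists N => n Nn.
    rewrite -iphi; [|exact: (xP _).1|exact: (xP _).1].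
    have := metric_triangle (phi (x N)) y (phi (x n)).
    have := (xP N).2; have := (xP n).2; have := NP _ Nn; have := NP _ (leqnn N).
    rewrite (metric_sym y (phi (x N))); lra.
  have sl : spt mu l.
    apply: (@closed_cvg _ _ _ _ x) xl => //; first exact: spt_closed.
    by apply: nearW => n; exact: (xP n).1.
  exists l => //; apply/esym/mdist_positivity/eqP; rewrite eq_le mdist_ge0 andbT.
  apply/ler_addgt0Pr => c c0; rewrite add0r.
  have [N NP] := half_pow_lt (divr_gt0 c0 (ltr0n R 2)).
  have [M MP] := (cvgn_mdistP _ _).1 xl _ (divr_gt0 c0 (ltr0n R 2)).
  have := metric_triangle y (phi (x (maxn N M))) (phi l).
  rewrite (iphi _ l (xP _).1 sl) (metric_sym (x _) l).
  have := MP _ (leq_maxr N M); have := NP _ (leq_maxl N M); have := (xP (maxn N M)).2.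
  lra.
Qed.

Lemma prob_equiv_eq mu nu : (forall A : set U, measurable (A : set (borel U)) -> mu A = nu A) ->
  prob_equiv mu nu.
Proof.
move=> h; apply: (@isometry_equiv _ _ idfun) => // A mA.
by rewrite (spt_setI aD)// h.
Qed.

Lemma prob_equiv_refl mu : prob_equiv mu mu.
Proof. exact: prob_equiv_eq. Qed.

Lemma prob_equiv_trans nu mu la : prob_equiv mu nu -> prob_equiv nu la -> prob_equiv mu la.
Proof.
move=> [phi [[fphi _ _] iphi hphi]] [psi [_ ipsi hpsi]].
apply: (@isometry_equiv _ _ (psi \o phi)) => [x y sx sy|A mA].
  by rewrite /= ipsi ?iphi//; exact: fphi.
rewrite -hpsi// -hphi; last exact: spt_preimage_borel.
congr (mu _); apply/seteqP; split=> [x [sx Ax]|x [sx [_ Ax]]] //; split=> //.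
by split=> //; exact: fphi.
Qed.

Lemma prob_equiv_sym mu nu : prob_equiv mu nu -> prob_equiv nu mu.
Proof.
move=> [phi [[fphi jphi sphi] iphi hphi]].
have /choice[psi psiP] : forall y, exists x, spt nu y -> spt mu x /\ phi x = y.
  move=> y; have [/sphi[x sx <-]|ny] := pselect (spt nu y); first by exists x.
  by exists y.
have ipsi : isometry_on (spt nu) psi.
  move=> y z sy sz; have [sy' ey] := psiP _ sy; have [sz' ez] := psiP _ sz.
  by rewrite -[in RHS]ey -[in RHS]ez iphi.
apply: (@isometry_equiv _ _ psi) => // A mA.
rewrite -hphi; last exact: spt_preimage_borel.
rewrite -[RHS](spt_setI aD)//; congr (mu _); apply/seteqP.
have psiK x : spt mu x -> psi (phi x) = x.
  move=> sx; have [sx' e] := psiP _ (fphi _ sx).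
  by apply: jphi => //; exact: mem_set.
split=> x [sx]; first by move=> [_ /=]; rewrite psiK.
by move=> Ax; split=> //; split; [exact: fphi|rewrite /= psiK].
Qed.

Lemma isometry_has_law nu (g : U -> U) : isometry_on setT g -> exists k, has_law nu g k.
Proof.
move=> ig; have mg := isometry_borel (@measurableT _ (borel U)) ig.
rewrite (_ : (fun x => _) = g) in mg; last by apply/funext => x; rewrite in_setT.
by exists (law nu mg); exact: lawP.
Qed.

Lemma isometry_law_equiv nu k (g : U -> U) : isometry_on setT g -> has_law nu g k ->
  prob_equiv nu k.
Proof.
move=> ig [mg hg]; apply: (@isometry_equiv _ _ g) => [x y _ _|A mA]; first exact: ig.
by rewrite (spt_setI aD) ?hg//; exact: (borel_preimage mg).
Qed.

Lemma Wass_isometry mu nu mu' nu' (g : U -> U) : isometry_on setT g ->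
  has_law mu g mu' -> has_law nu g nu' -> Wass mu' nu' <= Wass mu nu.
Proof.
move=> ig [mg hmu] [_ hnu]; apply: le_ereal_inf_tmp => _ [pi hpi <-].
have [f1 f2] := Adm_fst hpi; have [s1 s2] := Adm_snd hpi.
have comp (f : (U * U)%type -> U) (k k' : borel_prob R U) : has_law pi f k ->
    (forall A : set U, measurable (A : set (borel U)) -> k (g @^-1` A) = k' A) ->
    has_law pi (g \o f) k'.
  move=> [mf hf] h; split; first exact: (measurableT_comp mg mf).
  by move=> A mA; rewrite -h// -hf//; exact: (borel_preimage mg).
apply: le_trans (Wass_le_Erho aD (comp _ _ _ (Adm_fst hpi) hmu) (comp _ _ _ (Adm_snd hpi) hnu)) _.
by rewrite le_eqVlt; apply/orP; left; apply/eqP/eq_integral => z _; rewrite /rho /= ig.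
Qed.

(** Tightness at a single scale: the complements of the finite unions of balls decrease to the empty
    set. *)
Lemma prob_tight mu (r e : R) : (0 < r)%R -> (0 < e)%R ->
  exists K : nat, mu (~` \bigcup_(i in `I_K) [set y | (mdist (a i) y < r)%R]) < e%:E.
Proof.
move=> r0 e0; pose G K := ~` \bigcup_(i in `I_K) [set y | (mdist (a i) y < r)%R].
have mG K : measurable (G K : set (borel U)).
  apply: measurableC; apply: bigcup_measurable => i _; apply: open_borel; exact: open_mdist.
have G0 : \bigcap_K G K = set0.
  apply/seteqP; split=> // y h; have [i yi] := aD y r0.
  by apply: (h i.+1 I); exists i => //=; rewrite metric_sym.
have : mu \o G @ \oo --> mu (\bigcap_K G K).
  apply: nonincreasing_cvg_mu => //.
  - by apply: prob_lty; exact: mG.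
  - exact: bigcapT_measurable.
  - move=> m n mn; apply/subsetPset => y h [i /= im iy]; apply: h; exists i => //=.
    exact: leq_trans mn.
rewrite G0 measure0 => /fine_cvgP[_ /cvgrPdist_lt/(_ e e0)[N _ /(_ N (leqnn _))]] /=.
rewrite sub0r normrN => h; exists N; rewrite -/(G N) -(fineK (prob_fin mu (mG N))) lte_fin.
exact: le_lt_trans (ler_norm _) h.
Qed.

Lemma spt_neq0 mu : exists x, spt mu x.
Proof.
apply: contrapT => h; have := spt_full aD mu.
rewrite (_ : ~` spt mu = setT) ?probability_setT; last first.
  by apply/seteqP; split=> // x _ sx; apply: h; exists x.
by move/eqP; rewrite onee_eq0.
Qed.

(** Off a set of mass at most [e], a point is within [2 * e] of the net, so [f] and [g] differ there
    by at most [2 * e + e + 2 * e]; the bad set adds the sixth [e]. The net depends on [nu] alone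
    and is fixed before the two maps. *)
Lemma isometry_net nu (e : R) : (0 < e)%R -> exists (x : nat -> U) (K : nat),
  (forall i, spt nu (x i)) /\ forall f g : U -> U,
    measurable_fun setT (f : borel U -> borel U) -> measurable_fun setT (g : borel U -> borel U) ->
    isometry_on (spt nu) f -> isometry_on (spt nu) g ->
    (forall i, (i < K)%N -> (mdist (f (x i)) (g (x i)) <= e)%R) ->
    Erho nu (f : borel U -> U) g <= (6 * e)%:E.
Proof.
move=> e0; have [K KP] := prob_tight nu e0 e0; have [x0 sx0] := spt_neq0 nu.
(* A centre [a i] may lie outside the support, where [f] and [g] are not isometric. A support point
   of its ball replaces it and doubles the radius; [x0] is the default when the ball misses the
   support. *)
have /choice[x xP] : forall i, exists y, spt nu y /\
    forall z, spt nu z -> (mdist (a i) z < e)%R -> (mdist y z < 2 * e)%R.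
  move=> i; have [[y [sy iy]]|h] := pselect (exists y, spt nu y /\ (mdist (a i) y < e)%R).
    exists y; split=> // z sz iz; have := metric_triangle y (a i) z.
    rewrite (metric_sym y (a i)); lra.
  by exists x0; split=> // z sz iz; exfalso; apply: h; exists z.
exists x, K; split=> [i|f g mf mg fi gi fg]; first exact: (xP i).1.
set B := \bigcup_(i in _) _ in KP.
have mB : measurable (B : set (borel U)).
  by apply: bigcup_measurable => i _; apply: open_borel; exact: open_mdist.
have mD : measurable (~` B `|` ~` spt nu : set (borel U)).
  by apply: measurableU; apply: measurableC => //; exact: spt_borel.
have D1 : nu (~` B `|` ~` spt nu) <= e%:E.
  apply: (le_trans (measureU2 _ _ _)); [exact: measurableC|by apply: measurableC; exact: spt_borel|].
  rewrite -[leRHS]adde0; apply: leeD; first exact: ltW.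
  by rewrite le_eqVlt; apply/orP; left; apply/eqP; exact: (spt_full aD).
rewrite (_ : 6 * e = 5 * e + e)%R; last by ring.
rewrite EFinD; apply: le_trans (leeD (lexx _) D1); apply: (Erho_le_set aD) => //.
  by rewrite mulr_ge0// ltW.
move=> y nD.
have [By sy] : B y /\ spt nu y by split; apply: contrapT => h; apply: nD; [left|right].
have [i /= iK iy] := By; have xy := (xP i).2 _ sy iy.
apply: le_trans (rho_le _ _) _.
have := metric_triangle (f y) (f (x i)) (g y); have := metric_triangle (f (x i)) (g (x i)) (g y).
rewrite (fi _ _ sy (xP i).1) (gi _ _ (xP i).1 sy) (metric_sym y).
have := fg _ iK; lra.
Qed.

End equivalence.

(** * Equivalence classes are closed *)

Section orbits.
Context {R : realType} {U : pmetricType R}.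
Variables (a : nat -> U) (aD : dense_seq a) (cU : complete_metric U).
Variable hU : ultrahomogeneous_metric U.
Local Open Scope ereal_scope.
Implicit Types (mu nu la : borel_prob R U).

(* An isometry between supports need not extend to [U], but its restriction to a finite net does. *)
Lemma equiv_approx mu mu' (e : R) : prob_equiv mu mu' -> (0 < e)%R ->
  exists (g : U -> U) k, [/\ isometry_on setT g, has_law mu g k & Wass mu' k <= e%:E].
Proof.
move=> [phi [_ iphi hphi]] e0; have hl := spt_isometry_law aD iphi hphi.
have e60 : (0 < e / 6)%R by rewrite divr_gt0.
have [x [K [sx net]]] := isometry_net aD mu e60.
have [||g [_ ig gphi]] := hU (F := x @` `I_K) (phi := phi).
- exact/finite_image/finite_II.
- by move=> _ _ [i _ <-] [j _ <-]; exact: iphi.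
have [k hk] := isometry_has_law mu ig.
exists g, k; split=> //; apply: le_trans (Wass_le_Erho aD hl hk) _.
rewrite (_ : e = 6 * (e / 6))%R; last by field.
apply: net; [exact: hl.1|exact: hk.1| | |].
- by move=> y z sy sz; rewrite !mem_set// iphi.
- by move=> y z _ _; exact: ig.
- by move=> i iK; rewrite mem_set// gphi ?mdistxx ?ltW//; exists i.
Qed.

Lemma equiv_transfer mu mu' nu (e : R) : prob_equiv mu mu' -> (0 < e)%R ->
  exists2 nu', prob_equiv nu nu' & Wass mu' nu' <= Wass mu nu + e%:E.
Proof.
move=> mm' e0; have [g [k [ig hk Wk]]] := equiv_approx mm' e0.
have [nu' hnu'] := isometry_has_law nu ig.
exists nu'; first exact: (isometry_law_equiv aD cU ig hnu').
apply: le_trans (Wass_triangle aD cU k mu' nu') _.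
by rewrite addeC; apply: leeD => //; exact: (Wass_isometry aD ig hk hnu').
Qed.

(** Pigeonhole for ultrafilters; it turns total boundedness of an orbit into convergence along the
    ultrafilter. *)
Lemma ultra_finite_union (G : set_system nat) (Q : nat -> set nat) (K : nat) : UltraFilter G ->
  G [set n | exists2 i, (i < K)%N & Q i n] -> exists i, G (Q i).
Proof.
move=> UG; elim: K => [|K IH] h.
  have := filter_ex h; by case=> n [].
have [QK|nQK] := in_ultra_setVsetC (Q K) UG; first by exists K.
apply: IH; apply: filterS (filterI h nQK) => n [[i iK Qi] nQ].
by exists i => //; rewrite ltn_neqAle -ltnS iK andbT; apply/eqP => iE; apply: nQ; rewrite -iE.
Qed.

(* A ball around [g n x] carries a fixed amount of mass of [k n], hence almost as much of [mu]: it
   meets any set which carries nearly all the mass of [mu]. *)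
Lemma orbit_tight mu nu (g : nat -> U -> U) (k : nat -> borel_prob R U) x (r : R) :
  (forall n, isometry_on setT (g n)) -> (forall n, has_law nu (g n) (k n)) ->
  (forall e : R, (0 < e)%R -> exists N, forall n, (N <= n)%N -> Wass mu (k n) < e%:E) ->
  spt nu x -> (0 < r)%R -> exists K N, forall n, (N <= n)%N ->
    exists2 i, (i < K)%N & (mdist (a i) (g n x) < r)%R.
Proof.
move=> ig hk Wk sx r0.
have r40 : (0 < r / 4)%R by rewrite divr_gt0.
have r20 : (0 < r / 2)%R by rewrite divr_gt0.
have mB y s : measurable ([set z | (mdist y z < s)%R] : set (borel U)).
  by apply: open_borel; exact: open_mdist.
have := (spt_ballP nu x).1 sx _ r40.
rewrite -(fineK (prob_fin nu (mB x (r / 4)%R))); set c := fine _ => c0.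
rewrite lte_fin in c0; have c20 : (0 < c / 2)%R by rewrite divr_gt0.
have [K KP] := prob_tight aD mu r20 c20.
(* [Wass_thick] asks for a radius at most 1. Two steps of [r / 4] and the radius [r / 2] of the net
   add up to [r]. The thickened ball has mass at least [c / 2], and the part of [mu] outside the net
   has less. *)
pose r1 : R := Num.min (r / 4)%R 1%R.
have r10 : (0 < r1 <= 1)%R by rewrite lt_min r40 ltr01 ge_min lexx orbT.
have [N NP] := Wk (c / 2 * r1)%R (mulr_gt0 c20 (andP r10).1).
exists K, N => n /NP; rewrite (Wass_sym aD) => /(Wass_thick aD (mB (g n x) (r / 4)%R) r10).
rewrite -(hk n).2// (_ : _ @^-1` _ = [set y | (mdist x y < r / 4)%R]); last first.
  by apply/seteqP; split=> y /=; rewrite ig.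
rewrite -(fineK (prob_fin nu (mB x (r / 4)%R))) -/c => H.
apply: contrapT => nK.
have : mu (thick [set z | (mdist (g n x) z < r / 4)%R] r1) < (c / 2)%:E.
  apply: le_lt_trans KP; apply: prob_le.
  - by apply: open_borel; exact: thick_open.
  - by apply: measurableC; apply: bigcup_measurable.
  - move=> z [y /= gy yz] [i /= iK iz]; apply: nK; exists i => //.
    have r14 : (r1 <= r / 4)%R by rewrite ge_min lexx.
    have := metric_triangle (a i) z (g n x); have := metric_triangle z y (g n x).
    rewrite (metric_sym z y) (metric_sym y (g n x)); lra.
move: H; case: (mu _) => [m||]//; rewrite -EFinD lee_fin lte_fin; lra.
Qed.

(** An ultrafilter gives limits at all points of the support at once, without a diagonal extraction.
    Convergence is only pointwise, but a finite net turns it into closeness of the image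
    measures. *)
Lemma equiv_closed mu nu :
  (forall e : R, (0 < e)%R -> exists (g : U -> U) k,
    [/\ isometry_on setT g, has_law nu g k & Wass mu k < e%:E]) -> prob_equiv nu mu.
Proof.
move=> h.
have /choice[gk gkP] : forall n : nat, exists gk : (U -> U) * borel_prob R U,
    [/\ isometry_on setT gk.1, has_law nu gk.1 gk.2 & Wass mu gk.2 < n.+1%:R^-1%:E].
  by move=> n; have [|g [k ?]] := h (n.+1%:R^-1)%R; [rewrite invr_gt0 ltr0n|exists (g, k)].
pose g n := (gk n).1; pose k n := (gk n).2.
have ig n : isometry_on setT (g n) by have [] := gkP n.
have hk n : has_law nu (g n) (k n) by have [] := gkP n.
have Wk (e : R) : (0 < e)%R -> exists N, forall n, (N <= n)%N -> Wass mu (k n) < e%:E.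
  move=> e0; have [N _ NP] := near_infty_natSinv_lt (PosNum e0).
  exists N => n /NP /= ne; have [_ _] := gkP n; move=> /lt_trans; apply.
  by rewrite lte_fin.
have [G [UG leG]] := ultraFilterLemma eventually_filter.
have Gge N : G [set n | (N <= n)%N] by apply: leG; exists N.
have cvgG x : spt nu x -> exists l : U, g n x @[n --> G] --> l.
  move=> sx; apply: (cU (F := g n x @[n --> G])).
  apply: cauchy_exP => r r0; have [K [N KN]] := orbit_tight ig hk Wk sx r0.
  have [i Gi] := @ultra_finite_union G (fun i => [set n | (mdist (a i) (g n x) < r)%R]) K UG
    (filterS (fun n Nn => KN n Nn) (Gge N)).
  exists (a i); rewrite ballEmdist; exact: Gi.
pose psi x : U := xget (point : U) [set l : U | g n x @[n --> G] --> l].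
have psiP x (e : R) : spt nu x -> (0 < e)%R -> G [set n | (mdist (psi x) (g n x) < e)%R].
  move=> sx e0; have : g n x @[n --> G] --> psi x.
    by rewrite /psi; case: xgetP => [l _ //|/= hl]; have [l /hl] := cvgG x sx.
  move=> /(_ [set y | (mdist (psi x) y < e)%R]); apply.
  by rewrite -nbhs_ballE; exists e => //= y; rewrite ballEmdist.
have ipsi : isometry_on (spt nu) psi.
  move=> x y sx sy; apply/eqP; rewrite eq_le; apply/andP; split; apply/ler_addgt0Pr => e e0;
    have e20 : (0 < e / 2)%R by rewrite divr_gt0.
    have [n [/= nx ny]] := filter_ex (filterI (psiP x _ sx e20) (psiP y _ sy e20)).
    rewrite -(ig n x y I I); have := metric_triangle (psi x) (g n x) (psi y).
    have := metric_triangle (g n x) (g n y) (psi y); rewrite (metric_sym (g n y)).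
    by move: nx ny; lra.
  have [n [/= nx ny]] := filter_ex (filterI (psiP x _ sx e20) (psiP y _ sy e20)).
  rewrite -(ig n x y I I); have := metric_triangle (g n x) (psi x) (g n y).
  have := metric_triangle (psi x) (psi y) (g n y); rewrite (metric_sym (g n x) (psi x)).
  by move: nx ny; lra.
have mpsi := isometry_borel (spt_borel nu) ipsi.
have Wpsi : Wass mu (law nu mpsi) = 0.
  apply/eqP; rewrite eq_le Wass_ge0 andbT; apply/lee_addgt0Pr => e e0; rewrite add0e.
  have e120 : (0 < e / 12)%R by rewrite divr_gt0.
  have e20 : (0 < e / 2)%R by rewrite divr_gt0.
  have [x [K [sx net]]] := isometry_net aD nu e120.
  have [N NP] := Wk _ e20.
  (* Finitely many conditions hold together along the filter, so a single [n] serves the whole net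
     and the bound on [Wass mu (k n)]. *)
  have GK : G [set n | forall i, (i < K)%N -> (mdist (psi (x i)) (g n (x i)) < e / 12)%R].
    elim: K {net} => [|K IH]; first by apply: filterS (Gge 0%N).
    apply: filterS (filterI IH (psiP (x K) _ (sx K) e120)) => n [hn nK] i.
    by rewrite ltnS leq_eqVlt => /predU1P[->|/hn].
  have [n [/= Nn nK]] := filter_ex (filterI (Gge N) GK).
  apply: le_trans (Wass_triangle aD cU (k n) _ _) _.
  rewrite (_ : e = e / 2 + 6 * (e / 12))%R; last by field.
  rewrite EFinD; apply: leeD; first exact/ltW/NP.
  apply: le_trans (Wass_le_Erho aD (hk n) (lawP nu mpsi)) _.
  apply: net => //; first exact: (hk n).1.
  - by move=> y z _ _; exact: ig.
  - by move=> y z sy sz; rewrite !mem_set// ipsi.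
  - by move=> i iK; rewrite mem_set// metric_sym ltW// nK.
apply: (isometry_equiv aD cU ipsi) => A mA; rewrite (Wass_eq0 aD Wpsi)//.
apply: etrans (spt_setI aD nu (borel_preimage mpsi mA)); congr (nu _); apply/seteqP.
by split=> x /= [sx]; rewrite mem_set.
Qed.

End orbits.

(** * The distance on the quotient *)

Section quotient_distance.
Context {R : realType} {U : pmetricType R}.
Variables (a : nat -> U) (aD : dense_seq a) (cU : complete_metric U).
Variable hU : ultrahomogeneous_metric U.
Local Open Scope ereal_scope.
Implicit Types (mu nu la : prob U) (theta eta zeta : prob_quot U).

Lemma quot_memP theta mu nu : prob_quot_set theta mu -> (prob_quot_set theta nu <-> prob_equiv mu nu).
Proof.
case: theta => S [mu0 SE]; rewrite /prob_quot_set /= SE /= => h0; split.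
  by move=> h1; apply: (prob_equiv_trans aD cU) h1; exact: (prob_equiv_sym aD cU).
exact: (prob_equiv_trans aD cU).
Qed.

Lemma quot_ex theta : exists mu, prob_quot_set theta mu.
Proof.
case: theta => S [mu0 SE]; exists mu0; rewrite /prob_quot_set /= SE.
exact: (prob_equiv_refl aD cU).
Qed.

Lemma prob_class_mem mu : prob_quot_set (prob_class mu) mu.
Proof. exact: (prob_equiv_refl aD cU). Qed.

Lemma quot_ext theta eta mu : prob_quot_set theta mu -> prob_quot_set eta mu -> theta = eta.
Proof.
move=> tm em; have : theta = eta :> set (prob U).
  by apply/seteqP; split=> nu /= h;
    [apply/(quot_memP _ em)/(quot_memP _ tm)|apply/(quot_memP _ tm)/(quot_memP _ em)].
case: theta {tm} => S hS; case: eta {em} => T hT; rewrite /prob_quot_set /= => ST.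
exact: eq_exist.
Qed.

Lemma dist_W_lb theta eta mu nu : prob_quot_set theta mu -> prob_quot_set eta nu -> dist_W theta eta <= Wass mu nu.
Proof. by move=> tm en; apply: ereal_inf_lbound; exists (mu, nu). Qed.

Lemma dist_W_ge0 theta eta : 0 <= dist_W theta eta.
Proof. by apply: le_ereal_inf_tmp => _ [[mu nu] _ <-]; exact: Wass_ge0. Qed.

Lemma dist_W_fin theta eta : dist_W theta eta \is a fin_num.
Proof.
have [mu tm] := quot_ex theta; have [nu en] := quot_ex eta.
rewrite ge0_fin_numE ?dist_W_ge0//; apply: le_lt_trans (dist_W_lb tm en) _.
by rewrite ltey_eq (Wass_fin aD cU).
Qed.

Lemma dist_WC theta eta : dist_W theta eta = dist_W eta theta.
Proof.
wlog suff : theta eta / dist_W theta eta <= dist_W eta theta.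
  by move=> h; apply/eqP; rewrite eq_le !h.
apply: le_ereal_inf_tmp => _ [[mu nu] [/= em tn] <-].
by rewrite (Wass_sym aD); exact: dist_W_lb.
Qed.

Lemma dist_W_fiber theta eta mu : prob_quot_set theta mu ->
  ereal_inf [set Wass mu nu | nu in eta] = dist_W theta eta.
Proof.
move=> tm; apply/eqP; rewrite eq_le; apply/andP; split; last first.
  by apply: le_ereal_inf_tmp => _ [nu en <-]; exact: dist_W_lb.
apply: le_ereal_inf_tmp => _ [[mu' nu'] [/= tm' en'] <-]; apply/lee_addgt0Pr => e e0.
have mm' : prob_equiv mu' mu by exact/(quot_memP _ tm').
have [nu nn' W] := equiv_transfer aD cU hU nu' mm' e0.
apply: le_trans W; apply: ereal_inf_lbound; exists nu => //.
exact/(quot_memP _ en').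
Qed.

(** The representative [mu] is prescribed, so a sequence of classes can be lifted to measures one
    step at a time. *)
Lemma dist_W_attained theta eta mu (e : R) : prob_quot_set theta mu -> (dist_W theta eta < e%:E) ->
  exists2 nu, prob_quot_set eta nu & Wass mu nu < e%:E.
Proof.
move=> tm; rewrite -(dist_W_fiber eta tm) => /ereal_inf_lt[_ [nu en <-] ?].
by exists nu.
Qed.

Lemma W_H_dist_W theta eta : W_H theta eta = dist_W theta eta.
Proof.
have [mu tm] := quot_ex theta; have [nu en] := quot_ex eta.
rewrite /W_H (_ : [set _ | _ in _] = [set dist_W theta eta]); last first.
  apply/seteqP; split=> [_ [mu' tm' <-]|_ ->] /=; first exact: dist_W_fiber.
  by exists mu => //; exact: dist_W_fiber.
rewrite [X in maxe _ (ereal_sup X)](_ : _ = [set dist_W theta eta]); last first.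
  have E nu' : prob_quot_set eta nu' -> ereal_inf [set Wass mu' nu' | mu' in theta] = dist_W theta eta.
    move=> en'; rewrite dist_WC -(dist_W_fiber theta en'); congr ereal_inf.
    by apply/seteqP; split=> _ [k ? <-]; exists k; rewrite // (Wass_sym aD).
  by apply/seteqP; split=> [_ [nu' en' <-]|_ ->] /=; [exact: E|exists nu => //; exact: E].
by rewrite ereal_sup1 maxxx.
Qed.

Lemma dist_W_triangle eta theta zeta :
  dist_W theta zeta <= dist_W theta eta + dist_W eta zeta.
Proof.
apply/lee_addgt0Pr => e e0; have e20 : (0 < e / 2)%R by rewrite divr_gt0.
have [mu tm] := quot_ex theta.
have lt (x y : prob_quot U) : dist_W x y < (fine (dist_W x y) + e / 2)%:E.
  by rewrite EFinD fineK ?dist_W_fin// lteDl ?dist_W_fin// lte_fin.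
have [nu en W1] := dist_W_attained tm (lt theta eta).
have [la zl W2] := dist_W_attained en (lt eta zeta).
apply: le_trans (dist_W_lb tm zl) _.
apply: le_trans (Wass_triangle aD cU nu mu la) _.
apply: le_trans (leeD (ltW W1) (ltW W2)) _.
by rewrite !EFinD !fineK ?dist_W_fin// addeACA -EFinD -splitr.
Qed.

Lemma dist_W_eq0 theta eta : dist_W theta eta = 0 -> theta = eta.
Proof.
move=> d0; have [mu tm] := quot_ex theta; have [nu en] := quot_ex eta.
suff nm : prob_equiv nu mu by apply: quot_ext tm _; exact/(quot_memP _ en).
apply: (equiv_closed aD cU) => e e0; have e20 : (0 < e / 2)%R by rewrite divr_gt0.
have [|nu' en' W] := @dist_W_attained theta eta mu (e / 2) tm; first by rewrite d0 lte_fin.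
have nn' : prob_equiv nu nu' by exact/(quot_memP _ en).
have [g [k [ig hk Wk]]] := equiv_approx aD hU nn' e20.
exists g, k; split=> //; apply: le_lt_trans (Wass_triangle aD cU nu' mu k) _.
by rewrite (splitr e) EFinD; apply: lte_leD => //; rewrite ?(Wass_fin aD cU).
Qed.

Lemma dist_Wxx theta : dist_W theta theta = 0.
Proof.
have [mu tm] := quot_ex theta; apply/eqP; rewrite eq_le dist_W_ge0 andbT.
by rewrite -(Wassxx aD mu); exact: dist_W_lb.
Qed.

(** Chains collapse by the triangle inequality for [dist_W], because [nu i] and [mu i.+1] belong to
    the same class. *)
Lemma W_bar_dist_W theta eta : W_bar theta eta = dist_W theta eta.
Proof.
apply/eqP; rewrite eq_le; apply/andP; split.
  apply: le_ereal_inf_tmp => _ [[mu nu] [/= tm en] <-]; apply: ereal_inf_lbound.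
  exists 0%N, (fun=> mu), (fun=> nu); split=> //.
  by rewrite big_ord_recl big_ord0 adde0.
apply: le_ereal_inf_tmp => _ [n [mu [nu [tm en mn ->]]]].
elim: n eta en mn => [|n IH] eta en mn.
  by rewrite big_ord_recl big_ord0 adde0; exact: dist_W_lb.
rewrite big_ord_recr /=; apply: le_trans (dist_W_triangle (prob_class (nu n)) _ _) _.
apply: leeD.
  by apply: IH => [|i ni]; [exact: prob_class_mem|apply: mn; exact: ltnW].
by apply: dist_W_lb => //; exact: (mn n (ltnSn n)).
Qed.

End quotient_distance.

(* [hU] is a phantom argument which carries the hypothesis into the metric structure of the alias. *)
Definition quot_metric (R : realType) (U : pmetricType R) (hU : urysohn U) := prob_quot U.

Section quot_metric.
Context {R : realType} {U : pmetricType R}.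
Variable hU : urysohn U.
Local Notation M := (quot_metric hU).

Definition quot_dist (theta eta : prob_quot U) : R := fine (dist_W theta eta).

Lemma urysohn_dense : exists a : nat -> U, dense_seq a.
Proof. by case: hU => _ /separable_dense_seq. Qed.

Lemma quot_distE (theta eta : prob_quot U) : (quot_dist theta eta)%:E = dist_W theta eta.
Proof.
by have [a aD] := urysohn_dense; have [cU _ _ _] := hU; rewrite fineK// (dist_W_fin aD cU).
Qed.

Lemma quot_distxx theta : quot_dist theta theta = 0.
Proof.
by have [a aD] := urysohn_dense; have [cU _ _ _] := hU; rewrite /quot_dist (dist_Wxx aD cU).
Qed.

Lemma quot_dist_positivity theta eta : quot_dist theta eta = 0 -> theta = eta.
Proof.
have [a aD] := urysohn_dense; have [cU _ _ uU] := hU.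
move=> d0; apply: (dist_W_eq0 aD cU uU).
by rewrite -quot_distE d0.
Qed.

Lemma quot_distC theta eta : quot_dist theta eta = quot_dist eta theta.
Proof. by have [a aD] := urysohn_dense; rewrite /quot_dist (dist_WC aD). Qed.

Lemma quot_dist_triangle eta theta zeta :
  quot_dist theta zeta <= quot_dist theta eta + quot_dist eta zeta.
Proof.
have [a aD] := urysohn_dense; have [cU _ _ uU] := hU.
by rewrite -lee_fin EFinD !quot_distE; exact: (dist_W_triangle aD cU uU).
Qed.

HB.instance Definition _ := gen_eqMixin M.
HB.instance Definition _ := gen_choiceMixin M.
HB.instance Definition _ := isMetric.Build R M
  quot_distxx quot_dist_positivity quot_distC quot_dist_triangle.

Lemma quot_mdistE (theta eta : M) :
  (mdist theta eta)%:E = dist_W (theta : prob_quot U) (eta : prob_quot U).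
Proof. exact: quot_distE. Qed.

Lemma quot_complete : complete_metric M.
Proof.
have [a aD] := urysohn_dense; have [cU _ _ uU] := hU.
move=> F PF /cauchyP FC.
have p0 n : (0 : R) < 2^-1 ^+ n by rewrite exprn_gt0// invr_gt0.
have pS n : (2^-1 ^+ n : R) = 2 * 2^-1 ^+ n.+1 by rewrite exprS mulrA divff// mul1r.
(* Two consecutive balls belong to the filter, hence meet. The radii [2^-1 ^+ n.+2] and
   [2^-1 ^+ n.+3] then put their centres at distance below [2^-1 ^+ n.+1], the rate that
   [Wass_complete] expects. *)
have /choice[th thP] : forall n, exists th : M, F (ball th (2^-1 ^+ n.+2)).
  by move=> n; exact: FC.
have tS n : mdist (th n) (th n.+1) < 2^-1 ^+ n.+1.
  have [z []] := filter_ex (filterI (thP n) (thP n.+1)).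
  rewrite !ballEmdist /= => h1 h2; have := metric_triangle (th n) z (th n.+1).
  rewrite (metric_sym z); have := pS n.+1; have := pS n.+2; have := p0 n.+3; lra.
have [mu0 tm0] := quot_ex aD cU (th 0%N).
have [|mu [_ tm muS]] := @sequential_choice (prob U) (fun n mu => prob_quot_set (th n : prob_quot U) mu)
  (fun n mu nu => (Wass mu nu < (1 / (2 ^ n.+1)%:R)%:E)%E) mu0 tm0.
  move=> n mu tm; have := @dist_W_attained R U a aD cU uU (th n) (th n.+1) mu (1 / (2 ^ n.+1)%:R) tm.
  move=> [|nu ? ?]; last by exists nu.
  by rewrite -quot_mdistE lte_fin div1r natrX -exprVn.
have [la Wla] := Wass_complete aD cU (@ler01 R) muS.
have tla n : mdist (th n) (prob_class (la : prob U) : M) <= 2^-1 ^+ n.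
  rewrite -lee_fin quot_mdistE; apply: le_trans (dist_W_lb (tm n) (prob_class_mem aD cU la)) _.
  by apply: le_trans (Wla n) _; rewrite lee_fin div1r natrX -exprVn.
exists (prob_class (la : prob U) : M) => A; rewrite -nbhs_ballE => -[e /= e0 eA].
have [n /(_ n (leqnn n)) ne] := half_pow_lt (divr_gt0 e0 (ltr0n R 2)).
apply: filterS (thP n) => z; rewrite ballEmdist /= => h; apply: eA; rewrite ballEmdist /=.
have := metric_triangle (prob_class (la : prob U) : M) (th n) z.
rewrite (metric_sym (prob_class (la : prob U) : M) (th n)).
have := tla n; have := pS n; have := pS n.+1; have := p0 n.+2; move: h ne; lra.
Qed.

Lemma quot_open (B : set M) :
  @open M B <-> @open (quotient_topology (prob_quot U)) B.
Proof.
have [a aD] := urysohn_dense; have [cU _ _ uU] := hU.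
have -> : @open (quotient_topology (prob_quot U)) B = prob_open [set mu | B (prob_class mu)].
  rewrite -[LHS]/(prob_open (\pi_(prob_quot U)%qT @^-1` B)); congr prob_open.
  by rewrite unlock.
split=> [oB mu /= Bmu|oB].
  have [e e0 eB] := (open_mdistP B).1 oB _ Bmu; exists e => // nu W; apply: eB.
  rewrite -lte_fin quot_mdistE; apply: le_lt_trans W.
  by apply: dist_W_lb; exact: (prob_class_mem aD cU).
(* Openness at one representative is enough: every class close to [theta] contains a measure close
   to that representative. *)
apply/open_mdistP => theta Bt; have [mu tm] := quot_ex aD cU theta.
have [|e e0 eB] := oB mu.
  by rewrite /= (quot_ext aD cU (prob_class_mem aD cU mu) tm).
exists e => // eta te; rewrite -lte_fin quot_mdistE in te.
have [nu en /eB /=] := dist_W_attained aD cU uU tm te.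
by rewrite (quot_ext aD cU (prob_class_mem aD cU nu) en).
Qed.

End quot_metric.

(** * Separability *)

Section separability.
Context {R : realType} {U : pmetricType R}.
Variables (a : nat -> U) (aD : dense_seq a) (cU : complete_metric U).
Local Notation P := (@unif R).
Local Open Scope ereal_scope.

(** For a sorted [s], the step function with breakpoints [s]: it is [j] between the breakpoints of
    index [j.-1] and [j], and [size s] beyond the last one. *)
Definition threshold (s : seq R) (w : R) : nat := find (fun r => (w <= r)%R) s.

Lemma threshold_lt (s : seq R) (n : nat) : (n <= size s)%N ->
  [set w | (threshold s w < n)%N] = \bigcup_(j in `I_n) `]-oo, nth 0%R s j]%classic.
Proof.
move=> ns; apply/seteqP; split=> w /=; rewrite -has_take_leq//.
  move=> /(has_nthP 0%R)[j]; rewrite size_takel// => jn; rewrite nth_take// => wj.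
  by exists j => //=; rewrite in_itv.
move=> [j /= jn]; rewrite in_itv /= => wj; apply/(has_nthP 0%R); exists j.
  by rewrite size_takel.
by rewrite nth_take.
Qed.

Lemma threshold_lt_measurable (s : seq R) (n : nat) : measurable [set w | (threshold s w < n)%N].
Proof.
have [ns|sn] := leqP n (size s).
  by rewrite threshold_lt//; apply: bigcup_measurable => j _; exact: measurable_itv.
rewrite (_ : mkset _ = setT)//; apply/seteqP; split=> // w _ /=.
exact: leq_ltn_trans (find_size _ _) sn.
Qed.

Lemma fiber_lt (T : Type) (Z : T -> nat) (n : nat) :
  [set w | Z w = n] = [set w | (Z w < n.+1)%N] `\` [set w | (Z w < n)%N].
Proof.
apply/seteqP; split=> w /=; first by move=> ->; rewrite ltnSn ltnn.
by move=> [h /negP]; rewrite -leqNgt => h'; apply/eqP; rewrite eqn_leq h' -ltnS h.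
Qed.

Lemma threshold_measurable (s : seq R) (n : nat) : measurable [set w | threshold s w = n].
Proof. by rewrite fiber_lt; apply: measurableD; exact: threshold_lt_measurable. Qed.

Lemma unif_ray01 (r : R) : (0 <= r <= 1)%R -> P `]-oo, r] = r%:E.
Proof.
move=> /andP[r0 r1]; rewrite /unif /mrestr.
rewrite (_ : _ `&` _ = `[0%R, r]%classic).
  by rewrite lebesgue_measure_itv /= lte_fin; case: ltgtP r0 => // [_|<-] _; rewrite ?oppr0 ?adde0.
apply/seteqP; split=> w /=; rewrite !in_itv /=; first by move=> [-> /andP[->]].
by move=> /andP[-> wr]; rewrite wr (le_trans wr).
Qed.

Lemma fiber_lt_measure_eq d (T : measurableType d) (Q : probability T R)
    d' (T' : measurableType d') (Q' : probability T' R) (Z : T -> nat) (W : T' -> nat) :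
  (forall n, measurable [set w | (Z w < n)%N]) -> (forall n, measurable [set w | (W w < n)%N]) ->
  (forall n, Q [set w | (Z w < n)%N] = Q' [set w | (W w < n)%N]) ->
  forall n, Q [set w | Z w = n] = Q' [set w | W w = n].
Proof.
move=> mZ mW ZW n; rewrite !fiber_lt !measureD//; try exact: prob_lty.
have sub (S : Type) (V : S -> nat) :
    [set w | (V w < n.+1)%N] `&` [set w | (V w < n)%N] = [set w | (V w < n)%N].
  by apply: setIidr => w /= /ltnW.
by rewrite !sub; congr (_ - _)%E; exact: ZW.
Qed.

Definition threshold_law (t : seq rat) : borel_prob R U :=
  law P (@borel_comp_nat R U _ _ a _ (threshold_measurable [seq ratr r | r <- t])).

Lemma threshold_law_dense (mu : borel_prob R U) (e : R) : (0 < e)%R ->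
  exists t, Wass mu (threshold_law t) < e%:E.
Proof.
(* The error is [c] for the size of the cells, [c] for the mass outside the first [K] balls and [c]
   for making the breakpoints rational: three quarters of [e]. *)
move=> e0; pose c := (e / 4)%R; have c0 : (0 < c)%R by rewrite divr_gt0.
have [K KP] := prob_tight aD mu c0 c0; set B := \bigcup_(i in _) _ in KP.
(* Capping the index at [K] leaves [K.+1] values, so [K] breakpoints suffice. *)
pose cK x := minn (cell a c x) K.
have mcell n : measurable ([set x | (cell a c x < n)%N] : set (borel U)).
  exact: (fiber_measurable (fun k => cell_measurable aD k c0) (fun k => (k < n)%N)).
have mcK n : measurable ([set x | (cK x < n)%N] : set (borel U)).
  exact: (fiber_measurable (fun k => cell_measurable aD k c0) (fun k => (minn k K < n)%N)).
pose sg j := fine (mu [set x | (cell a c x < j.+1)%N]).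
have sgE j : mu [set x | (cell a c x < j.+1)%N] = (sg j)%:E.
  by rewrite fineK// prob_fin.
have sg01 j : (0 <= sg j <= 1)%R.
  by rewrite -2!lee_fin -sgE measure_ge0/=; exact: probability_le1.
have sgmono i j : (i <= j)%N -> (sg i <= sg j)%R.
  move=> ij; rewrite -lee_fin -!sgE; apply: prob_le => // x /= h.
  exact: leq_trans h _.
pose ssg := [seq sg j | j <- iota 0 K].
have sK : size ssg = K by rewrite size_map size_iota.
have nsg j : (j < K)%N -> nth 0%R ssg j = sg j.
  by move=> jK; rewrite (nth_map 0%N) ?size_iota// nth_iota.
(* The breakpoints are the values of the cumulative distribution function of the cell index, so the
   step function is its quantile function capped at [K]. *)
have lawK n : P [set w | (threshold ssg w < n)%N] = mu [set x | (cK x < n)%N].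
  have [nK|Kn] := leqP n K; last first.
    rewrite (_ : [set w | _] = setT); last first.
      apply/seteqP; split=> // w _ /=; apply: leq_ltn_trans (find_size _ _) _.
      by rewrite sK.
    rewrite [X in _ = mu X](_ : _ = setT).
      exact: etrans (probability_setT P) (esym (probability_setT mu)).
    by apply/seteqP; split=> // x _ /=; rewrite gtn_min Kn orbT.
  rewrite threshold_lt ?sK// [X in _ = mu X](_ : _ = [set x | (cell a c x < n)%N]); last first.
    by apply/seteqP; split=> x /=; rewrite gtn_min [(K < n)%N]ltnNge nK orbF.
  case: n nK => [|n] nK.
    rewrite (_ : `I_0 = set0); last by apply/seteqP; split.
    rewrite bigcup_set0 measure0 (_ : mkset _ = set0) ?measure0//.
    by apply/seteqP; split.
  rewrite (_ : \bigcup_(j in _) _ = `]-oo, sg n]%classic) ?unif_ray01//.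
  apply/seteqP; split=> w /=.
    by move=> [j /= jn]; rewrite nsg ?(leq_trans jn)// !in_itv /= => /le_trans; apply; exact: sgmono.
  by move=> wn; exists n => //=; rewrite nsg.
have mth s := @borel_comp_nat R U _ _ a _ (threshold_measurable s).
have mk : measurable_fun setT (a \o cK : borel U -> borel U).
  apply: borel_comp_nat => n; rewrite fiber_lt; apply: measurableD; exact: mcK.
pose k := law P (mth ssg).
have hk : has_law mu (a \o cK) k.
  split=> // A mA; apply/esym.
  apply: (@fiber_measure_eq R _ _ P _ _ mu (threshold ssg) cK _ _ _ (a @^-1` A)).
  - exact: threshold_measurable.
  - by move=> n; rewrite fiber_lt; apply: measurableD; exact: mcK.
  - apply: fiber_lt_measure_eq => //; exact: threshold_lt_measurable.
have mB : measurable (~` B : set (borel U)).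
  by apply: measurableC; apply: bigcup_measurable => i _; apply: open_borel; exact: open_mdist.
have W1 : Wass mu k <= (c + c)%:E.
  apply: le_trans (Wass_le_Erho aD (has_law_id mu) hk) _.
  rewrite EFinD; apply: le_trans (leeD (lexx _) (ltW KP)).
  apply: (@Erho_le_set _ _ _ aD _ _ mu idfun (a \o cK) (~` B) c
    (@measurable_id _ (borel U) setT) mk mB (ltW c0)) => x nBx.
   have /contrapT[i /= iK ix] : ~ ~ B x by [].
  have xi : (cell a c x <= i)%N.
    rewrite /cell; case: pselect => [h|[]]; last by exists i; rewrite metric_sym.
    by case: (ex_minnP h) => m _ /(_ i); apply; rewrite metric_sym.
  rewrite /cK /= (minn_idPl _); last exact: leq_trans xi (ltnW iK).
  exact: rho_cell.
have d0 : (0 < c / K.+1%:R)%R by rewrite divr_gt0.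
have /choice[q qP] : forall j, exists q : rat, (sg j < ratr q < sg j + c / K.+1%:R)%R.
  move=> j; have [|q] := @rat_in_itvoo R (sg j) (sg j + c / K.+1%:R)%R; first by rewrite ltrDl.
  by rewrite in_itv; exists q.
pose t := [seq q j | j <- iota 0 K].
exists t.
(* Moving each breakpoint up from [sg j] to [q j] changes the step function only on these [K]
   intervals, each of mass at most [c / K.+1%:R]. *)
pose D := \bigcup_(j in `I_K) `]sg j, ratr (q j) : R]%classic.
have mD : measurable D by apply: bigcup_measurable => j _; exact: measurable_itv.
have PD : P D <= c%:E.
  rewrite /D bigcup_mkord.
  apply: (@le_trans _ _ (\sum_(j < K) P `]sg j, ratr (q j) : R]%classic)).
    exact: (@Boole_inequality _ _ _ P (fun j => `]sg j, ratr (q j) : R]%classic) K (fun _ _ => measurable_itv _)).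
  apply: (@le_trans _ _ (\sum_(j < K) (c / K.+1%:R)%:E)).
    apply: lee_sum => j _; have /andP[q1 q2] := qP j.
    apply: le_trans (unif_itv (ltW q1)) _; rewrite lee_fin lerBlDl; exact: ltW.
  rewrite sumEFin lee_fin sumr_const card_ord -[leLHS]mulr_natr mulrAC.
  by rewrite ler_pdivrMr ?ltr0n// ler_pM2l// ler_nat.
have W2 : Wass k (threshold_law t) <= c%:E.
  apply: le_trans (Wass_le_Erho aD (lawP P _) (lawP P _)) _.
  rewrite -[leRHS]add0e; apply: le_trans (leeD (lexx (0%R)%:E) PD).
  apply: (@Erho_le_set _ _ _ aD _ _ P (a \o threshold ssg) (a \o threshold [seq ratr r | r <- t])
    D 0%R (mth _) (mth _) mD (lexx _)) => w nDw /=.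
  rewrite (_ : threshold _ w = threshold ssg w) ?rhoxx//.
  rewrite /threshold /ssg /t -map_comp !find_map; apply: eq_in_find => j.
  rewrite mem_iota /= add0n => jK; have /andP[q1 _] := qP j.
  apply/idP/idP => [wq|/le_trans]; last by apply; exact: ltW.
  by rewrite leNgt; apply/negP => sw; apply: nDw; exists j => //=; rewrite in_itv /= sw wq.
apply: le_lt_trans (Wass_triangle aD cU k _ _) _.
apply: le_lt_trans (leeD W1 W2) _; rewrite -EFinD lte_fin /c; lra.
Qed.

End separability.

(** * Length structure *)

Section mixture.
Local Open Scope ereal_scope.
Context d (T : measurableType d) (R : realType) (p q r : {nonneg R}).
Variables (m1 m2 m3 : probability T R).
Hypothesis pqr : (p%:num + q%:num + r%:num)%R = 1%R.

(** The equation on the weights is an argument so that the probability instance can recover it from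
    the term. *)
Definition mixture (_ : (p%:num + q%:num + r%:num)%R = 1%R) : set T -> \bar R :=
  measure_add (mscale p m1) (measure_add (mscale q m2) (mscale r m3)).

HB.instance Definition _ := Measure.copy (mixture pqr)
  (measure_add (mscale p m1) (measure_add (mscale q m2) (mscale r m3))).

Lemma mixtureE A : mixture pqr A = p%:num%:E * m1 A + (q%:num%:E * m2 A + r%:num%:E * m3 A).
Proof. by rewrite /mixture measure_addE; congr (_ + _); exact: measure_addE. Qed.

Lemma mixtureT : mixture pqr setT = 1.
Proof. by rewrite mixtureE !probability_setT !mule1 -!EFinD addrA pqr. Qed.

HB.instance Definition _ := Measure_isProbability.Build _ _ R (mixture pqr) mixtureT.

Lemma mixture_exists : exists m : probability T R,
  (forall A, m A = p%:num%:E * m1 A + (q%:num%:E * m2 A + r%:num%:E * m3 A)) /\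
  forall f : T -> \bar R, measurable_fun setT f -> (forall x, 0 <= f x) ->
    \int[m]_(x in setT) f x = p%:num%:E * \int[m1]_(x in setT) f x +
      (q%:num%:E * \int[m2]_(x in setT) f x + r%:num%:E * \int[m3]_(x in setT) f x).
Proof.
exists (mixture pqr); split=> [A|f mf f0]; first exact: mixtureE.
rewrite ge0_integral_measure_add// ge0_integral_measure_add//.
by rewrite !ge0_integral_mscale.
Qed.

End mixture.

Section geodesics.
Context {R : realType} {U : pmetricType R}.
Variables (a : nat -> U) (aD : dense_seq a) (cU : complete_metric U).
Local Open Scope ereal_scope.
Implicit Types (mu nu : borel_prob R U) (s t : R).

Lemma segment_exists mu nu t : (0 <= t <= 1)%R ->
  exists m : borel_prob R U, forall A, m A = (1 - t)%:E * mu A + t%:E * nu A.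
Proof.
move=> /andP[t0 t1]; have t10 : (0 <= 1 - t)%R by rewrite subr_ge0.
have [|m [mE _]] := @mixture_exists _ (borel U) R (NngNum t10) (NngNum t0) (NngNum (lexx 0%R)) mu nu nu.
  by rewrite /= addr0 subrK.
by exists m => A; rewrite mE /= mul0e adde0.
Qed.

(* The mass common to both measures stays put: the segment has constant speed for [W], which is a
   1-Wasserstein distance. *)
Lemma segment_Wass mu nu s t (ms mt : borel_prob R U) (c : R) : (0 <= s)%R -> (s <= t)%R -> (t <= 1)%R ->
  (forall A, ms A = (1 - s)%:E * mu A + s%:E * nu A) ->
  (forall A, mt A = (1 - t)%:E * mu A + t%:E * nu A) ->
  Wass mu nu < c%:E -> Wass ms mt <= ((t - s) * c)%:E.
Proof.
move=> s0 st t1 msE mtE /Wass_lt[pi hpi Ipi].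
have t10 : (0 <= 1 - t)%R by rewrite subr_ge0.
have ts0 : (0 <= t - s)%R by rewrite subr_ge0.
have mdiag := pair_borel aD (@measurable_id _ (borel U) setT) (@measurable_id _ (borel U) setT).
have [f1 f2] := Adm_fst hpi; have [s1 s2] := Adm_snd hpi.
(* The coupling leaves the part [1 - t] of [mu] and the part [s] of [nu] on the diagonal, and moves
   only the remaining [t - s] along [pi]. *)
have [|k [kE kI]] := @mixture_exists _ (borel (U * U)%type) R (NngNum t10) (NngNum ts0) (NngNum s0)
    (law mu mdiag) pi (law nu mdiag).
  by rewrite /=; ring.
have hk : Adm ms mt k.
  move=> A mA; rewrite !kE /= f2// s2// msE mtE.
  have -> : law mu mdiag (fst @^-1` A) = mu A by [].
  have -> : law mu mdiag (snd @^-1` A) = mu A by [].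
  have -> : law nu mdiag (fst @^-1` A) = nu A by [].
  have -> : law nu mdiag (snd @^-1` A) = nu A by [].
  rewrite -(fineK (prob_fin mu mA)) -(fineK (prob_fin nu mA)) -!EFinM -!EFinD.
  by split; congr EFin; ring.
have diag0 la : Erho (law la mdiag) (fst : _ -> U) (snd : _ -> U) = 0.
  rewrite /Erho ge0_integral_distribution//=.
  - by apply: integral0_eq => x _; rewrite /= rhoxx.
  - exact: (measurable_Erho aD).
  - by move=> z; rewrite lee_fin rho_ge0.
apply: (@le_trans _ _ (Erho k (fst : _ -> U) (snd : _ -> U))).
  by apply: ereal_inf_lbound; exists k.
rewrite /Erho kI; last by move=> z; rewrite lee_fin rho_ge0.
  rewrite -/(Erho (law mu mdiag) (fst : _ -> U) (snd : _ -> U)) diag0.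
  rewrite -/(Erho (law nu mdiag) (fst : _ -> U) (snd : _ -> U)) diag0.
  rewrite !mule0 add0e adde0 EFinM; apply: lee_wpmul2l; rewrite ?lee_fin//.
  exact: ltW.
exact: (measurable_Erho aD).
Qed.

End geodesics.

Section length.
Context {R : realType} {M : metricType R}.

Lemma mdist_le_curve_length (g : R -> M) : ((mdist (g 0) (g 1))%:E <= curve_length g)%E.
Proof.
apply: ereal_sup_ubound; exists [:: 1].
  by split; rewrite //= ltr01.
by congr EFin; rewrite /polygonal_length /= big_nat1.
Qed.

Lemma Lipschitz_curve_length (g : R -> M) (c : R) :
  (forall s t, 0 <= s -> s <= t -> t <= 1 -> mdist (g s) (g t) <= (t - s) * c) ->
  (curve_length g <= c%:E)%E.
Proof.
move=> gc; apply: ge_ereal_sup => _ [s [sp /eqP sl] <-]; rewrite lee_fin /polygonal_length.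
pose x n := nth 1 (0 :: s) n.
have xlt n : (n < size s)%N -> x n < x n.+1.
  by move=> ns; have /(pathP 1)/(_ n ns) := sp.
have xmono m n : (m <= n)%N -> (n <= size s)%N -> x m <= x n.
  move=> mn; elim: n mn => [|n IH]; first by rewrite leqn0 => /eqP ->.
  rewrite leq_eqVlt => /predU1P[-> //|mn] ns.
  by apply: le_trans (IH mn (ltnW ns)) _; exact/ltW/xlt.
have x1 : x (size s) = 1 by rewrite /x -[size s]/(size (0 :: s)).-1 nth_last.
apply: (@le_trans _ _ (\sum_(0 <= n < size s) (x n.+1 - x n) * c)).
  rewrite big_nat [leRHS]big_nat; apply: ler_sum => n /= ns; apply: gc.
  - exact: (xmono 0%N n (leq0n n) (ltnW ns)).
  - exact/ltW/xlt.
  - by apply: le_trans (xmono n.+1 _ ns (leqnn _)) _; rewrite x1.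
by rewrite -mulr_suml telescope_sumr// x1 /x /= subr0 mul1r.
Qed.

Lemma Lipschitz_continuous (g : R -> M) (c : R) : 0 < c ->
  (forall s t, s <= t -> mdist (g s) (g t) <= (t - s) * c) -> continuous g.
Proof.
move=> c0 gc t A; rewrite -nbhs_ballE => -[e /= e0 eA].
have : nbhs t (ball t (e / c)) by apply: nbhsx_ballx; rewrite divr_gt0.
apply: filterS => u tu; apply: eA; rewrite ballEmdist /=.
have tue : `|t - u| * c < e by rewrite -ltr_pdivlMr.
apply: le_lt_trans tue; have [tu'|/ltW ut] := leP t u.
  by rewrite ler0_norm ?subr_le0// opprB; exact: gc.
by rewrite ger0_norm ?subr_ge0// metric_sym; exact: gc.
Qed.

End length.

Section quot_metric_space.
Context {R : realType} {U : pmetricType R}.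
Variable hU : urysohn U.
Local Notation M := (quot_metric hU).

Lemma quot_separable : separable_metric M.
Proof.
have [a aD] := urysohn_dense hU; have [cU _ _ uU] := hU.
exists (range (fun t => prob_class (threshold_law a t : prob U) : M)).
  by apply: (sub_countable (B := [set: seq rat])); [exact: card_image_le|exact: countableP].
move=> O [theta Ot] oO; have [mu tm] := quot_ex aD cU theta.
have [e e0 eO] := (open_mdistP O).1 oO _ Ot.
have [t W] := threshold_law_dense aD cU mu e0.
exists (prob_class (threshold_law a t : prob U)); split; last by exists t.
apply: eO; rewrite -lte_fin quot_mdistE; apply: le_lt_trans W.
by apply: dist_W_lb => //; exact: (prob_class_mem aD cU).
Qed.

Lemma quot_length : length_space M.
Proof.
have [a aD] := urysohn_dense hU; have [cU _ _ uU] := hU.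
move=> theta eta; apply/eqP; rewrite eq_le; apply/andP; split.
  by apply: le_ereal_inf_tmp => _ [g [_ <- <-] <-]; exact: mdist_le_curve_length.
apply/lee_addgt0Pr => e e0; rewrite -EFinD; set c := _ + e.
have c0 : 0 < c by rewrite ltr_wpDl// mdist_ge0.
have [mu tm] := quot_ex aD cU theta.
have [|nu en W] := @dist_W_attained R U a aD cU uU theta eta mu c tm.
  by rewrite -quot_mdistE lte_fin ltrDl.
(* Curves are functions on the whole line, while the mixture is a probability for weights in
   [[0, 1]] only; clamping is 1-Lipschitz and keeps the speed. *)
pose clamp (t : R) := Num.max 0 (Num.min t 1).
have clamp01 t : 0 <= clamp t <= 1.
  by rewrite /clamp le_max lexx ge_max ler01 ge_min lexx orbT.
have clampE t : 0 <= t <= 1 -> clamp t = t.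
  by move=> /andP[t0 t1]; rewrite /clamp min_l// max_r.
have clamp_lip s t : s <= t -> 0 <= clamp t - clamp s <= t - s.
  by rewrite /clamp /Num.max /Num.min; do ![case: ifP]; move=> *; apply/andP; split; lra.
have /choice[m mE] : forall t, exists m : borel_prob R U,
    forall A, m A = ((1 - clamp t)%:E * mu A + (clamp t)%:E * nu A)%E.
  by move=> t; exact: segment_exists.
pose g t : M := prob_class (m t : prob U).
have glip s t : s <= t -> mdist (g s) (g t) <= (t - s) * c.
  move=> st; have /andP[ts0 ts] := clamp_lip _ _ st.
  apply: (@le_trans _ _ ((clamp t - clamp s) * c)); last by rewrite ler_pM2r.
  rewrite -lee_fin quot_mdistE.
  apply: le_trans (dist_W_lb (prob_class_mem aD cU _) (prob_class_mem aD cU _)) _.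
  have /andP[s0 _] := clamp01 s; have /andP[_ t1] := clamp01 t.
  by apply: (segment_Wass aD s0 _ t1 (mE s) (mE t) W); rewrite -subr_ge0.
have g0 : g 0 = theta.
  apply: (@quot_ext R U a aD cU _ _ mu); last exact: tm.
  apply/(quot_memP aD cU _ (prob_class_mem aD cU _))/(prob_equiv_eq aD cU) => A _.
  by rewrite mE clampE ?lexx ?ler01// subr0 mul1e mul0e adde0.
have g1 : g 1 = eta.
  apply: (@quot_ext R U a aD cU _ _ nu); last exact: en.
  apply/(quot_memP aD cU _ (prob_class_mem aD cU _))/(prob_equiv_eq aD cU) => A _.
  by rewrite mE clampE ?lexx ?ler01// subrr mul1e mul0e add0e.
apply: (@le_trans _ _ (curve_length g)); last first.
  by apply: Lipschitz_curve_length => s t _ st _; exact: glip.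
apply: ereal_inf_lbound; exists g => //; split=> //.
by apply: continuous_subspaceT; exact: Lipschitz_continuous glip.
Qed.

End quot_metric_space.

Theorem theorem3p1 (R : realType) (U : pmetricType R) (hU : urysohn U) :
  (exists m : Metric.axioms_ R (prob_quot U),
     let M : metricType R := Metric.Pack m in
     [/\ forall theta eta : prob_quot U,
           (@mdist R M theta eta)%:E = W_H theta eta,
         complete_metric M,
         separable_metric M,
         length_space M
       & forall B : set (prob_quot U),
           @open M B <-> @open (quotient_topology (prob_quot U)) B])
  /\
  (forall theta eta : prob_quot U,
     W_bar theta eta = dist_W theta eta /\ dist_W theta eta = W_H theta eta).
Proof.
have [a aD] := urysohn_dense hU; have [cU _ _ uU] := hU.
split=> [|theta eta]; last by rewrite (W_bar_dist_W aD cU uU) (W_H_dist_W aD cU uU).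
(* [quot_metric hU] unfolds to [prob_quot U], so its metric structure is one on the quotient
   itself. *)
exists (Metric.class (quot_metric hU)) => M; split.
- by move=> theta eta; rewrite (W_H_dist_W aD cU uU); exact: quot_mdistE.
- exact: quot_complete.
- exact: quot_separable.
- exact: quot_length.
- exact: quot_open.
Qed.
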